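(* Let $d,r\ge1$ be integers and let $\lambda,\mu$ be two $d$-partitions of $r$. Let $\phi: u_j\mapsto\zeta_d^jq^{m_j}\ (0\le j<d),\ x\mapsto 1$ be a cyclotomic specialization of $\mathcal{H}_{d,r}$ associated with the essential hyperplane $N=0$. If $(\chi_\lambda)_\phi$ and $(\chi_\mu)_\phi$ belong to the same Rouquier block of $(\mathcal{H}_{d,r})_\phi$, then $$a((\chi_\lambda)_\phi)=a((\chi_\mu)_\phi)\quad\text{and}\quad A((\chi_\lambda)_\phi)=A((\chi_\mu)_\phi).$$
   Context: **Ariki-Koike algebras.** $\zeta_d:=\exp(2\pi i/d)$, $K:=\mathbb{Q}(\zeta_d)$, $\mathbb{Z}_K=\mathbb{Z}[\zeta_d]$, $\mu(K)$ is the group of roots of unity in $K$. The generic Ariki-Koike algebra $\mathcal{H}_{d,r}$ of $G(d,1,r)$ is the algebra over $\mathbb{Z}[u_0^{\pm1},\dots,u_{d-1}^{\pm1},x^{\pm1}]$ generated by $\mathbf{s},\mathbf{t}_1,\dots,\mathbf{t}_{r-1}$ with relations $\mathbf{s}\mathbf{t}_1\mathbf{s}\mathbf{t}_1=\mathbf{t}_1\mathbf{s}\mathbf{t}_1\mathbf{s}$, $\mathbf{s}\mathbf{t}_j=\mathbf{t}_j\mathbf{s}$ for $j\ne1$, $\mathbf{t}_j\mathbf{t}_{j+1}\mathbf{t}_j=\mathbf{t}_{j+1}\mathbf{t}_j\mathbf{t}_{j+1}$, $\mathbf{t}_i\mathbf{t}_j=\mathbf{t}_j\mathbf{t}_i$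 for $|i-j|>1$, $(\mathbf{s}-u_0)\cdots(\mathbf{s}-u_{d-1})=0$, $(\mathbf{t}_j-x)(\mathbf{t}_j+1)=0$. Over $\mathbb{Q}(u_0,\dots,u_{d-1},x)$ it is split semisimple, with irreducible characters $\chi_\lambda$ (characters of the Specht modules) indexed by the $d$-partitions $\lambda=(\lambda^{(0)},\dots,\lambda^{(d-1)})$ of $r$, labelled so that the element $x^{1-k}\mathbf{t}_{k-1}\cdots\mathbf{t}_1\mathbf{s}\mathbf{t}_1\cdots\mathbf{t}_{k-1}$ has, on the Specht module of $\lambda$, for each standard tableau of shape $\lambda$ the eigenvalue $u_a x^{j-i}$, where $k$ occupies row $i$, column $j$ of component $a$. **Schur elements.** The Schur element $s_\lambda$ of $\chi_\lambda$ (with respect to the canonical symmetrizing form of $\mathcal{H}_{d,r}$) is an element of $\mathbb{Z}[u_0^{\pm1},\dots,u_{d-1}^{\pm1},x^{\pm1}]$ given as follows (Mathas; Geck-Iancu-Malle). Fix $L$ at least the number of parts of every $\lambda^{(a)}$, put $b_i^{(a)}:=\lambda_i^{(a)}+L-i$ $(1\le i\le L$, missing parts being $0)$ and $B^{(a)}:=\{b^{(a)}_1,\dots,b^{(a)}_L\}$, $a_L:=r(d-1)+\binom d2\binom L2$, $b_L:=dL(L-1)(2dL-d-3)/12$. Then $s_\lambda=(-1)^{a_L}x^{b_L}(x-1)^{-r}(u_0\cdots u_{d-1})^{-r}\nu_\lambda/\delta_\lambda$ with $$\nu_\lambda=\prod_{0\le s<t<d}(u_s-u_t)^L\prod_{0\le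 s,t<d}\ \prod_{b\in B^{(s)}}\ \prod_{1\le k\le b}(x^ku_s-u_t),$$ $$\delta_\lambda=\prod_{0\le s<t<d}\ \prod_{(b,b')\in B^{(s)}\times B^{(t)}}(x^{b}u_s-x^{b'}u_t)\prod_{0\le s<d}\ \prod_{1\le i<j\le L}(x^{b_i^{(s)}}u_s-x^{b_j^{(s)}}u_s).$$ **Cyclotomic specialization.** With $y$ an indeterminate and $q:=y^{|\mu(K)|}$, integers $m_0,\dots,m_{d-1},n$ give $\phi:u_j\mapsto\zeta_d^jq^{m_j},\ x\mapsto q^n$, and the cyclotomic algebra $(\mathcal{H}_{d,r})_\phi$ over $\mathbb{Z}_K[y,y^{-1}]$. The algebra $K(y)(\mathcal{H}_{d,r})_\phi$ is split semisimple, with irreducible characters the specializations $(\chi_\lambda)_\phi$, whose Schur elements are $\phi(s_\lambda)$. We put $a((\chi_\lambda)_\phi):=\mathrm{val}_q(\phi(s_\lambda))$ (order at $q=0$) and $A((\chi_\lambda)_\phi):=\deg_q(\phi(s_\lambda))$ (degree as a Laurent polynomial in $q$). **Essential hyperplanes.** The essential hyperplanes for $G(d,1,r)$, in the space with coordinates $(M_0,\dots,M_{d-1},N)$, are: $N=0$; and $kN+M_s-M_t=0$ for $0\le s<t<d$, $-r<k<r$ such that $\zeta_d^s-\zeta_d^t\in\mathfrak{p}$ for some prime ideal $\mathfrak{p}$ of $\mathbb{Z}[\zeta_d]$. The specialization $\phi$ is associated with the essential hyperplane $H$ if $(m_0,\dots,m_{d-1},n)$ lies on $H$ and on no other essential hyperplane.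 **Rouquier blocks.** $\mathcal{R}_K(y):=\mathbb{Z}_K[y,y^{-1},(y^m-1)^{-1}_{m\ge1}]$. The Rouquier blocks of $(\mathcal{H}_{d,r})_\phi$ are the blocks of $\mathcal{R}_K(y)(\mathcal{H}_{d,r})_\phi$: the unique partition of the set of irreducible characters of $K(y)(\mathcal{H}_{d,r})_\phi$ such that the primitive idempotents of the center of $\mathcal{R}_K(y)(\mathcal{H}_{d,r})_\phi$ are the sums $\sum_{\chi\in B}e_\chi$, $B$ running over the parts ($e_\chi$ the central primitive idempotent attached to $\chi$). *)

(* Defs.v *)
From HB Require Import structures.
From mathcomp Require Import all_boot all_order all_algebra all_field.
From mathcomp Require Import generic_quotient ring_quotient.
From mathcomp Require Import boolp classical_sets functions cardinality fsbigop.

Set Implicit Arguments.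
Unset Strict Implicit.
Unset Printing Implicit Defensive.

Import Order.TTheory GRing.Theory Num.Theory.
Local Open Scope ring_scope.
Local Open Scope quotient_scope.

Section GeneratedSubring.
Variables (F : comNzRingType) (G : set F).

Definition gen_subring : {pred F} := fun z =>
  `[< forall S : {pred F}, subring_closed S ->
        (forall g, G g -> g \in S) -> z \in S >].

Lemma gen_subring_closed : subring_closed gen_subring.
Proof.
split.
- by apply/asboolP => S [S1 _ _] _.
- move=> a b /asboolP Ha /asboolP Hb; apply/asboolP => S HS HG.
  by case: (HS) => _ SB _; apply: SB; [exact: Ha | exact: Hb].
- move=> a b /asboolP Ha /asboolP Hb; apply/asboolP => S HS HG.
  by case: (HS) => _ _ SM; apply: SM; [exact: Ha | exact: Hb].
Qed.

Lemma mem_gen_subring g : G g -> g \in gen_subring.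
Proof. by move=> Gg; apply/asboolP => S _; apply. Qed.

HB.instance Definition _ :=
  GRing.isSubringClosed.Build F gen_subring gen_subring_closed.

Record subringT := SubringT { srval : F; _ : srval \in gen_subring }.

HB.instance Definition _ := [isSub for srval].
HB.instance Definition _ := [Choice of subringT by <:].
HB.instance Definition _ := [SubChoice_isSubComNzRing of subringT by <:].

Definition in_subring g (Gg : G g) : subringT := SubringT (mem_gen_subring Gg).

End GeneratedSubring.

Definition rscalars (R S : comNzRingType) (f : {rmorphism R -> S})
  (B : algType S) : Type := B.

Section RestrictScalars.
Variables (R S : comNzRingType) (f : {rmorphism R -> S}) (B : algType S).
Local Notation Bf := (rscalars f B).

HB.instance Definition _ := GRing.NzRing.copy Bf B.

Definition rscale (a : R) (b : Bf) : Bf := f a *: (b : B).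

Fact rscalerA a b v : rscale a (rscale b v) = rscale (a * b) v.
Proof. by rewrite /rscale scalerA rmorphM. Qed.
Fact rscale1r : left_id 1 rscale.
Proof. by move=> v; rewrite /rscale rmorph1 scale1r. Qed.
Fact rscalerDr : right_distributive rscale +%R.
Proof. by move=> a v1 v2; rewrite /rscale scalerDr. Qed.
Fact rscalerDl v : {morph rscale^~ v : a b / a + b}.
Proof. by move=> a b; rewrite /rscale rmorphD scalerDl. Qed.

HB.instance Definition _ := GRing.Zmodule_isLmodule.Build R Bf
  rscalerA rscale1r rscalerDr rscalerDl.

Fact rscalerAl (a : R) (v1 v2 : Bf) : a *: (v1 * v2) = (a *: v1) * v2.
Proof. exact: (@scalerAl S B). Qed.
HB.instance Definition _ := GRing.Lmodule_isLalgebra.Build R Bf rscalerAl.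

Fact rscalerAr (a : R) (v1 v2 : Bf) : a *: (v1 * v2) = v1 * (a *: v2).
Proof. exact: (@scalerAr S B). Qed.
HB.instance Definition _ := GRing.Lalgebra_isAlgebra.Build R Bf rscalerAr.

End RestrictScalars.

(* Throughout, [d.+1] is the integer called d in the mathematics (the algebra
   is nonzero only when there is at least one parameter u_j), and the element
   [t j], [j : 'I_r.-1], is the generator t_{j+1}. *)

Section ArikiKoike.
Variables (R : comNzRingType) (d r : nat) (u : 'I_d.+1 -> R) (x : R).

Record AK_relations (B : algType R) (s : B) (t : 'I_r.-1 -> B) : Prop := {
  AK_braid_st : forall j : 'I_r.-1, j = 0%N :> nat ->
    s * t j * s * t j = t j * s * t j * s;
  AK_comm_st : forall j : 'I_r.-1, j <> 0%N :> nat -> s * t j = t j * s;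
  AK_braid_tt : forall i j : 'I_r.-1, j = i.+1 :> nat ->
    t i * t j * t i = t j * t i * t j;
  AK_comm_tt : forall i j : 'I_r.-1, (i.+1 < j)%N -> t i * t j = t j * t i;
  AK_quad_s : \prod_(j < d.+1) (s - (u j)%:A) = 0;
  AK_quad_t : forall j : 'I_r.-1, (t j - x%:A) * (t j + 1) = 0
}.

Inductive AK_expr :=
  | AKs | AKt of 'I_r.-1 | AKc of R
  | AKadd of AK_expr & AK_expr | AKmul of AK_expr & AK_expr.

Fixpoint AK_eval (B : algType R) (s : B) (t : 'I_r.-1 -> B) (e : AK_expr) : B :=
  match e with
  | AKs => s
  | AKt j => t j
  | AKc a => a%:A
  | AKadd e1 e2 => AK_eval s t e1 + AK_eval s t e2
  | AKmul e1 e2 => AK_eval s t e1 * AK_eval s t e2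
  end.

(* Two expressions in the generators define the same element of the presented
   algebra iff they agree in all algebras whose given elements satisfy the
   relations; see [AK_gen_relations], [AK_lift] and [AK_lift_uniq] for the
   resulting universal property. *)
Definition AK_equiv (e1 e2 : AK_expr) : bool :=
  `[< forall (B : algType R) (s : B) (t : 'I_r.-1 -> B), AK_relations s t ->
        AK_eval s t e1 = AK_eval s t e2 >].

Fact AK_equiv_refl : reflexive AK_equiv.
Proof. by move=> e; apply/asboolP. Qed.
Fact AK_equiv_sym : symmetric AK_equiv.
Proof. by move=> e1 e2; apply/asboolP/asboolP => H B s t /H. Qed.
Fact AK_equiv_trans : transitive AK_equiv.
Proof.
move=> e2 e1 e3 /asboolP H12 /asboolP H23.
by apply/asboolP => B s t Hr; rewrite H12 ?H23.
Qed.

HB.instance Definition _ := gen_eqMixin AK_expr.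
HB.instance Definition _ := gen_choiceMixin AK_expr.

Canonical AK_equivRel :=
  EquivRel AK_equiv AK_equiv_refl AK_equiv_sym AK_equiv_trans.

Definition AK := {eq_quot AK_equivRel}.

HB.instance Definition _ := Choice.on AK.

Definition AKpi (e : AK_expr) : AK := \pi_({eq_quot AK_equivRel}) e.
Definition AKrepr (a : AK) : AK_expr := generic_quotient.repr a.

Definition AK_ev (B : algType R) (s : B) (t : 'I_r.-1 -> B) (a : AK) : B :=
  AK_eval s t (AKrepr a).

Lemma AK_ev_pi (B : algType R) (s : B) (t : 'I_r.-1 -> B) :
  AK_relations s t -> forall e, AK_ev s t (AKpi e) = AK_eval s t e.
Proof.
move=> Hr e; rewrite /AK_ev /AKrepr /AKpi.
have /eqmodP/asboolP : (generic_quotient.repr (\pi_({eq_quot AK_equivRel}) e)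
    = e %[mod {eq_quot AK_equivRel}]) by rewrite reprK.
exact.
Qed.

Lemma AK_ext (a b : AK) :
  (forall (B : algType R) (s : B) (t : 'I_r.-1 -> B), AK_relations s t ->
     AK_ev s t a = AK_ev s t b) -> a = b.
Proof.
move=> H; rewrite -[a]reprK -[b]reprK.
by apply/eqmodP/asboolP => B s t /H.
Qed.

Definition AK_zero : AK := AKpi (AKc 0).
Definition AK_one : AK := AKpi (AKc 1).
Definition AK_add (a b : AK) : AK := AKpi (AKadd (AKrepr a) (AKrepr b)).
Definition AK_mul (a b : AK) : AK := AKpi (AKmul (AKrepr a) (AKrepr b)).
Definition AK_scale (c : R) (a : AK) : AK := AKpi (AKmul (AKc c) (AKrepr a)).
Definition AK_opp (a : AK) : AK := AK_scale (-1) a.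

Section Evaluation.
Variables (B : algType R) (s : B) (t : 'I_r.-1 -> B) (Hr : AK_relations s t).
Lemma AK_ev0 : AK_ev s t AK_zero = 0.
Proof. by rewrite AK_ev_pi //= scale0r. Qed.
Lemma AK_ev1 : AK_ev s t AK_one = 1.
Proof. by rewrite AK_ev_pi //= scale1r. Qed.
Lemma AK_evD a b : AK_ev s t (AK_add a b) = AK_ev s t a + AK_ev s t b.
Proof. by rewrite AK_ev_pi. Qed.
Lemma AK_evM a b : AK_ev s t (AK_mul a b) = AK_ev s t a * AK_ev s t b.
Proof. by rewrite AK_ev_pi. Qed.
Lemma AK_evZ c a : AK_ev s t (AK_scale c a) = c *: AK_ev s t a.
Proof. by rewrite AK_ev_pi //= -scalerAl mul1r. Qed.
Lemma AK_evN a : AK_ev s t (AK_opp a) = - AK_ev s t a.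
Proof. by rewrite AK_evZ scaleN1r. Qed.
Definition AK_evE := (AK_ev0, AK_ev1, AK_evD, AK_evM, AK_evN, AK_evZ).
End Evaluation.

Fact AK_addA : associative AK_add.
Proof. by move=> a b c; apply: AK_ext => B s t H; rewrite !AK_evE // addrA. Qed.
Fact AK_addC : commutative AK_add.
Proof. by move=> a b; apply: AK_ext => B s t H; rewrite !AK_evE // addrC. Qed.
Fact AK_add0 : left_id AK_zero AK_add.
Proof. by move=> a; apply: AK_ext => B s t H; rewrite !AK_evE // add0r. Qed.
Fact AK_addN : left_inverse AK_zero AK_opp AK_add.
Proof. by move=> a; apply: AK_ext => B s t H; rewrite !AK_evE // addNr. Qed.
Fact AK_mulA : associative AK_mul.
Proof. by move=> a b c; apply: AK_ext => B s t H; rewrite !AK_evE // mulrA. Qed.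
Fact AK_mul1l : left_id AK_one AK_mul.
Proof. by move=> a; apply: AK_ext => B s t H; rewrite !AK_evE // mul1r. Qed.
Fact AK_mul1r : right_id AK_one AK_mul.
Proof. by move=> a; apply: AK_ext => B s t H; rewrite !AK_evE // mulr1. Qed.
Fact AK_mulDl : left_distributive AK_mul AK_add.
Proof. by move=> a b c; apply: AK_ext => B s t H; rewrite !AK_evE // mulrDl. Qed.
Fact AK_mulDr : right_distributive AK_mul AK_add.
Proof. by move=> a b c; apply: AK_ext => B s t H; rewrite !AK_evE // mulrDr. Qed.

Fact AK_relations_index :
  @AK_relations R^o (u ord0) (fun=> x).
Proof.
split.
- by move=> j _ /=; rewrite mulrC !mulrA.
- by move=> j _ /=; rewrite mulrC.
- by move=> i j _.
- by move=> i j _.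
- by rewrite big_ord_recl /= /GRing.scale /= mulr1 subrr mul0r.
- by move=> j; rewrite /GRing.scale /= mulr1 subrr mul0r.
Qed.

Fact AK_oner_neq0 : AK_one != AK_zero.
Proof.
apply/eqP => /(congr1 (AK_ev (B := R^o) (u ord0) (fun=> x))).
rewrite !AK_evE; try exact: AK_relations_index.
by move/eqP; rewrite oner_eq0.
Qed.

HB.instance Definition _ :=
  GRing.isZmodule.Build AK AK_addA AK_addC AK_add0 AK_addN.
HB.instance Definition _ := GRing.Zmodule_isNzRing.Build AK
  AK_mulA AK_mul1l AK_mul1r AK_mulDl AK_mulDr AK_oner_neq0.

Fact AK_scalerA a b v : AK_scale a (AK_scale b v) = AK_scale (a * b) v.
Proof. by apply: AK_ext => B s t H; rewrite !AK_evE // scalerA. Qed.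
Fact AK_scale1r : left_id 1 AK_scale.
Proof. by move=> v; apply: AK_ext => B s t H; rewrite !AK_evE // scale1r. Qed.
Fact AK_scalerDr : right_distributive AK_scale +%R.
Proof.
by move=> a v w; apply: AK_ext => B s t H; rewrite !AK_evE // scalerDr.
Qed.
Fact AK_scalerDl v : {morph AK_scale^~ v : a b / a + b}.
Proof.
by move=> a b; apply: AK_ext => B s t H; rewrite !AK_evE // scalerDl.
Qed.
HB.instance Definition _ := GRing.Zmodule_isLmodule.Build R AK
  AK_scalerA AK_scale1r AK_scalerDr AK_scalerDl.

Fact AK_scalerAl (a : R) (v w : AK) : a *: (v * w) = (a *: v) * w.
Proof. by apply: AK_ext => B s t H; rewrite !AK_evE // scalerAl. Qed.
HB.instance Definition _ := GRing.Lmodule_isLalgebra.Build R AK AK_scalerAl.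
Fact AK_scalerAr (a : R) (v w : AK) : a *: (v * w) = v * (a *: w).
Proof. by apply: AK_ext => B s t H; rewrite !AK_evE // scalerAr. Qed.
HB.instance Definition _ := GRing.Lalgebra_isAlgebra.Build R AK AK_scalerAr.

Definition AK_s : AK := AKpi AKs.
Definition AK_t (j : 'I_r.-1) : AK := AKpi (AKt j).

Section Lift.
Variables (B : algType R) (s : B) (t : 'I_r.-1 -> B).

Definition AK_lift (Hr : AK_relations s t) : AK -> B := AK_ev s t.

Variable Hr : AK_relations s t.

Lemma AK_lift_s : AK_lift Hr AK_s = s.
Proof. exact: AK_ev_pi. Qed.
Lemma AK_lift_t j : AK_lift Hr (AK_t j) = t j.
Proof. exact: AK_ev_pi. Qed.

Fact AK_lift_zmod_morphism : zmod_morphism (AK_lift Hr).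
Proof. by move=> a b; rewrite /AK_lift AK_evD // AK_evN. Qed.
Fact AK_lift_monoid_morphism : monoid_morphism (AK_lift Hr).
Proof. by split=> [|a b]; rewrite /AK_lift ?AK_ev1 ?AK_evM. Qed.
Fact AK_lift_scalable : scalable (AK_lift Hr).
Proof. by move=> c a; rewrite /AK_lift AK_evZ. Qed.

HB.instance Definition _ :=
  GRing.isZmodMorphism.Build AK B (AK_lift Hr) AK_lift_zmod_morphism.
HB.instance Definition _ :=
  GRing.isMonoidMorphism.Build AK B (AK_lift Hr) AK_lift_monoid_morphism.
HB.instance Definition _ :=
  GRing.isScalable.Build R AK B *:%R (AK_lift Hr) AK_lift_scalable.

End Lift.

Lemma AK_gen_relations : AK_relations AK_s AK_t.
Proof.
have E (B : algType R) (s : B) t (H : AK_relations s t) a :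
  AK_ev s t a = AK_lift H a by [].
split.
- move=> j j0; apply: AK_ext => B s t H; rewrite !E !rmorphM /= AK_lift_s AK_lift_t.
  exact: AK_braid_st H j j0.
- move=> j j0; apply: AK_ext => B s t H; rewrite !E !rmorphM /= AK_lift_s AK_lift_t.
  exact: AK_comm_st H j j0.
- move=> i j ij; apply: AK_ext => B s t H; rewrite !E !rmorphM /= !AK_lift_t.
  exact: AK_braid_tt H i j ij.
- move=> i j ij; apply: AK_ext => B s t H; rewrite !E !rmorphM /= !AK_lift_t.
  exact: AK_comm_tt H i j ij.
- apply: AK_ext => B s t H; rewrite !E rmorph0 rmorph_prod /= -(AK_quad_s H).
  by apply: eq_bigr => j _; rewrite rmorphB /= linearZ /= rmorph1 AK_lift_s.
- move=> j; apply: AK_ext => B s t H.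
  rewrite !E rmorph0 rmorphM /= rmorphB rmorphD /= linearZ /= rmorph1 AK_lift_t.
  exact: AK_quad_t H j.
Qed.

Lemma AK_evalE (a : AK) : AK_eval AK_s AK_t (AKrepr a) = a.
Proof.
apply: AK_ext => B s t H; rewrite -[AK_ev s t _]/(AK_lift H _).
rewrite -[RHS]/(AK_eval s t (AKrepr a)).
elim: (AKrepr a) => /= [|j|c|e1 <- e2 <-|e1 <- e2 <-].
- exact: AK_lift_s.
- exact: AK_lift_t.
- by rewrite linearZ /= rmorph1.
- exact: rmorphD.
- exact: rmorphM.
Qed.

Lemma AK_lift_uniq (B : algType R) (s : B) (t : 'I_r.-1 -> B)
    (H : AK_relations s t) (f : {lrmorphism AK -> B}) :
  f AK_s = s -> (forall j, f (AK_t j) = t j) -> f =1 AK_lift H.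
Proof.
move=> fs ft a; rewrite -(AK_evalE a).
elim: (AKrepr a) => /= [|j|c|e1 IH1 e2 IH2|e1 IH1 e2 IH2].
- by rewrite fs AK_lift_s.
- by rewrite ft AK_lift_t.
- by rewrite !linearZ /= !rmorph1.
- by rewrite !rmorphD /= IH1 IH2.
- by rewrite !rmorphM /= IH1 IH2.
Qed.

End ArikiKoike.

Arguments AK {R d} r u x.
Arguments AK_s {R d r u x}.
Arguments AK_t {R d r u x} j.

Section BaseChange.
Variables (R S : comNzRingType) (f : {rmorphism R -> S}) (d r : nat).
Variables (u : 'I_d.+1 -> R) (x : R).

Local Notation AKS := (AK r (fun j => f (u j)) (f x)).

Fact AK_map_relations :
  AK_relations u x (AK_s : rscalars f AKS) (AK_t : _ -> rscalars f AKS).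
Proof.
have [H1 H2 H3 H4 H5 H6] := AK_gen_relations r (fun j => f (u j)) (f x).
by split.
Qed.

Definition AK_map : AK r u x -> AKS := AK_lift AK_map_relations.

HB.instance Definition _ := GRing.isZmodMorphism.Build (AK r u x) AKS AK_map
  (AK_lift_zmod_morphism AK_map_relations).
HB.instance Definition _ := GRing.isMonoidMorphism.Build (AK r u x) AKS AK_map
  (AK_lift_monoid_morphism AK_map_relations).

Lemma AK_map_s : AK_map AK_s = AK_s.
Proof. exact: (AK_lift_s AK_map_relations). Qed.
Lemma AK_map_t j : AK_map (AK_t j) = AK_t j.
Proof. exact: (AK_lift_t AK_map_relations). Qed.
Lemma AK_mapZ c a : AK_map (c *: a) = f c *: AK_map a.
Proof. exact: (AK_lift_scalable AK_map_relations). Qed.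

End BaseChange.

Section Characters.
Variables (F : fieldType) (A : algType F).

Definition mx_irreducible n (rho : {lrmorphism A -> 'M[F]_n.+1}) : Prop :=
  forall V : 'M[F]_n.+1,
    (forall a, stablemx V (rho a)) -> V != 0 -> row_full V.

Definition irr_characters : set (A -> F) :=
  [set chi | exists n (rho : {lrmorphism A -> 'M[F]_n.+1}),
     mx_irreducible rho /\ forall a, chi a = \tr (rho a)].

End Characters.

Section Idempotents.
Variable A : nzRingType.

Definition central_idempotent (e : A) : Prop :=
  e * e = e /\ forall a, a * e = e * a.

Definition primitive_central_idempotent (e : A) : Prop :=
  [/\ central_idempotent e, e <> 0 &
      forall f g, central_idempotent f -> central_idempotent g ->
        f * g = 0 -> e = f + g -> f = 0 \/ g = 0].

End Idempotents.

(* [e] is the central primitive idempotent attached to the irreducible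
   character [chi]: it acts by 1 on [chi] and by 0 on the other ones. *)
Definition attached_idempotent (F : fieldType) (A : algType F)
    (chi : A -> F) (e : A) : Prop :=
  [/\ primitive_central_idempotent e,
      forall a, chi (e * a) = chi a &
      forall chi', irr_characters chi' -> chi' <> chi ->
        forall a, chi' (e * a) = 0].

Section Tableaux.
Variables (d r : nat).

Definition is_multipartition (lam : 'I_d.+1 -> seq nat) : Prop :=
  (forall a, sorted geq (lam a) /\ 0%N \notin lam a) /\
  (\sum_(a < d.+1) sumn (lam a) = r)%N.

(* (a, (i, j)) is the box in row i+1 and column j+1 of component a. *)
Definition box := ('I_d.+1 * (nat * nat))%type.

Definition in_diagram (lam : 'I_d.+1 -> seq nat) (b : box) : Prop :=
  (b.2.2 < nth 0 (lam b.1) b.2.1)%N.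

(* [T k] is the box occupied by the entry k+1. *)
Definition std_tableau (lam : 'I_d.+1 -> seq nat) (T : {ffun 'I_r -> box}) : Prop :=
  [/\ injective T,
      forall b, in_diagram lam b <-> exists k, T k = b,
      forall k l, (T k).1 = (T l).1 -> (T k).2.1 = (T l).2.1 ->
        ((T k).2.2 < (T l).2.2)%N -> (k < l)%N &
      forall k l, (T k).1 = (T l).1 -> (T k).2.2 = (T l).2.2 ->
        ((T k).2.1 < (T l).2.1)%N -> (k < l)%N].

End Tableaux.

(* Not imported earlier because it shadows [symmetric]. *)
From mathcomp Require Import mpoly.

Section Generic.
Variables (d r : nat).

(* The field Q(u_0, ..., u_d, x); the last variable is x. *)
Definition Qux : fieldType := {fraction {mpoly int[d.+2]}}.

Definition genu (j : 'I_d.+1) : Qux := tofrac 'X_(widen_ord (leqnSn d.+1) j).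
Definition genx : Qux := tofrac 'X_(@ord_max d.+1).

Definition laurent_gens : set Qux :=
  [set f | (exists j, f = genu j \/ f = (genu j)^-1) \/ f = genx \/ f = genx^-1].

Definition laurent : comNzRingType := subringT laurent_gens.
Definition laurent_incl : {rmorphism laurent -> Qux} := (val : laurent -> Qux).

Definition lau_u (j : 'I_d.+1) : laurent :=
  @in_subring _ laurent_gens (genu j) (or_introl (ex_intro _ j (or_introl erefl))).
Definition lau_x : laurent :=
  @in_subring _ laurent_gens genx (or_intror (or_introl erefl)).

Definition generic_AK := AK r lau_u lau_x.
Definition generic_AK_Qux :=
  AK r (fun j => laurent_incl (lau_u j)) (laurent_incl lau_x).
Definition generic_incl : generic_AK -> generic_AK_Qux :=
  @AK_map _ _ laurent_incl d r lau_u lau_x.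

(* x^{-k} t_k ... t_1 s t_1 ... t_k; since [k] starts at 0 it corresponds to the
   entry k+1 of a tableau. *)
Definition jucys_murphy (k : 'I_r) : generic_AK_Qux :=
  let js := take k (enum 'I_r.-1) in
  genx ^- k *: ((\prod_(j <- rev js) AK_t j) * AK_s * \prod_(j <- js) AK_t j).

Definition jm_eigenvalue (b : box d) : Qux :=
  genu b.1 * genx ^ (b.2.2%:Z - b.2.1%:Z).

(* The rows of [P] are joint eigenvectors, indexed by the standard tableaux of
   shape [lam], of all the elements [jucys_murphy k]. *)
Definition is_specht_character (lam : 'I_d.+1 -> seq nat)
    (chi : generic_AK_Qux -> Qux) : Prop :=
  exists n (rho : {lrmorphism generic_AK_Qux -> 'M[Qux]_n.+1}),
  [/\ mx_irreducible rho,
      forall h, chi h = \tr (rho h) &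
      exists (tab : 'I_n.+1 -> {ffun 'I_r -> box d}) (P : 'M[Qux]_n.+1),
      [/\ injective tab,
          forall T, std_tableau lam T <-> exists i, tab i = T,
          P \in unitmx &
          forall k, P *m rho (jucys_murphy k) =
            diag_mx (\row_i jm_eigenvalue (tab i k)) *m P]].

(* [beta lam L a i] is b_{i+1}^{(a)}: the index of rows starts at 0 here. *)
Definition beta (lam : 'I_d.+1 -> seq nat) (L : nat) (a : 'I_d.+1) (i : nat) : nat :=
  (nth 0 (lam a) i + (L - i.+1))%N.

Definition schur_aL (L : nat) : nat := (r * d + 'C(d.+1, 2) * 'C(L, 2))%N.

(* The division is exact; if the last factor is truncated then L <= 1 and the
   product is 0 anyway. *)
Definition schur_bL (L : nat) : nat :=
  ((d.+1 * L * L.-1 * (2 * d.+1 * L - d.+1 - 3)) %/ 12)%N.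

Definition schur_nu (lam : 'I_d.+1 -> seq nat) (L : nat) : Qux :=
  (\prod_(s < d.+1) \prod_(t < d.+1 | (s < t)%N) (genu s - genu t) ^+ L) *
  (\prod_(s < d.+1) \prod_(t < d.+1) \prod_(i < L)
     \prod_(1 <= k < (beta lam L s i).+1) (genx ^+ k * genu s - genu t)).

Definition schur_delta (lam : 'I_d.+1 -> seq nat) (L : nat) : Qux :=
  (\prod_(s < d.+1) \prod_(t < d.+1 | (s < t)%N) \prod_(i < L) \prod_(j < L)
     (genx ^+ beta lam L s i * genu s - genx ^+ beta lam L t j * genu t)) *
  (\prod_(s < d.+1) \prod_(i < L) \prod_(j < L | (i < j)%N)
     (genx ^+ beta lam L s i * genu s - genx ^+ beta lam L s j * genu s)).

Definition schur_formula (lam : 'I_d.+1 -> seq nat) (L : nat) : Qux :=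
  (-1) ^+ schur_aL L * genx ^+ schur_bL L * (genx - 1) ^- r *
  (\prod_(j < d.+1) genu j) ^- r * (schur_nu lam L / schur_delta lam L).

Definition is_schur_element (lam : 'I_d.+1 -> seq nat) (s : laurent) : Prop :=
  exists L : nat, (forall a, (size (lam a) <= L)%N) /\
    laurent_incl s = schur_formula lam L.

End Generic.

Arguments laurent_incl {d}.
Arguments generic_incl {d r}.
Arguments lau_u {d} j.

Definition roots_of_unity (K : fieldType) : set K :=
  [set z | exists2 n : nat, (0 < n)%N & z ^+ n = 1].

Section Cyclotomic.
Variables (K : fieldType) (zeta : K).

Definition Ky : fieldType := {fraction {poly K}}.
Definition Kyc (c : K) : Ky := tofrac c%:P.
Definition Kyy : Ky := tofrac 'X.

Definition ZK : comNzRingType := subringT [set zeta]%classic.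
Definition ZK_zeta : ZK := @in_subring K [set zeta]%classic zeta erefl.

Definition RK_gens : set Ky :=
  [set f | [\/ f = Kyc zeta, f = Kyy, f = Kyy^-1 |
             exists2 m : nat, (0 < m)%N & f = (Kyy ^+ m - 1)^-1]].

Definition RK : comNzRingType := subringT RK_gens.
Definition RK_incl : {rmorphism RK -> Ky} := (val : RK -> Ky).

Variables (d r : nat).

(* [w] stands for the number of roots of unity in K, so that [Kyy ^+ w] is q.
   A ring morphism from the Laurent polynomial ring is determined by the images
   of the u_j and x; these images lie in Z_K[y, y^{-1}], which is contained in
   R_K(y). *)
Definition cyclotomic_specialization (w : nat) (phi : {rmorphism laurent d -> RK})
    (m : 'I_d.+1 -> int) (n : int) : Prop :=
  (forall j : 'I_d.+1,
     RK_incl (phi (lau_u j)) = Kyc (zeta ^+ j) * (Kyy ^+ w) ^ m j) /\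
  RK_incl (phi (lau_x d)) = (Kyy ^+ w) ^ n.

Definition parameter_space := (('I_d.+1 -> rat) * rat)%type.

Definition hyperplaneN : set parameter_space := [set p | p.2 = 0].
Definition hyperplane (k : int) (s t : 'I_d.+1) : set parameter_space :=
  [set p | k%:~R * p.2 + p.1 s - p.1 t = 0].

Definition in_some_prime_ideal (z : ZK) : Prop :=
  exists I : {pred ZK}, [/\ idealr_closed I, prime_idealr_closed I & z \in I].

Definition essential_hyperplane (H : set parameter_space) : Prop :=
  H = hyperplaneN \/
  exists (k : int) (s t : 'I_d.+1),
    [/\ (s < t)%N, - r%:Z < k < r%:Z,
        in_some_prime_ideal (ZK_zeta ^+ s - ZK_zeta ^+ t) &
        H = hyperplane k s t].

Definition associated_with (m : 'I_d.+1 -> int) (n : int)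
    (H : set parameter_space) : Prop :=
  let p : parameter_space := (fun j => (m j)%:~R, n%:~R) in
  [/\ essential_hyperplane H, H p &
      forall H', essential_hyperplane H' -> H' p -> H' = H].

Section Specialized.
Variable phi : {rmorphism laurent d -> RK}.

Definition cyc_AK_RK := AK r (fun j => phi (lau_u j)) (phi (lau_x d)).
Definition cyc_AK_Ky :=
  AK r (fun j => RK_incl (phi (lau_u j))) (RK_incl (phi (lau_x d))).

Definition cyc_incl : cyc_AK_RK -> cyc_AK_Ky :=
  @AK_map _ _ RK_incl d r (fun j => phi (lau_u j)) (phi (lau_x d)).
Definition cyc_spec : generic_AK d r -> cyc_AK_RK :=
  @AK_map _ _ phi d r (@lau_u d) (lau_x d).

(* [psi] is the K(y)-linear function with psi (phi h) = phi (chi h). *)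
Definition specialized_character (chi : generic_AK_Qux d r -> Qux d)
    (psi : cyc_AK_Ky -> Ky) : Prop :=
  scalar psi /\
  forall h : generic_AK d r, exists c : laurent d,
    chi (generic_incl h) = laurent_incl c /\
    psi (cyc_incl (cyc_spec h)) = RK_incl (phi c).

Definition rouquier_partition (P : set (set (cyc_AK_Ky -> Ky))) : Prop :=
  partition P id (@irr_characters Ky cyc_AK_Ky) /\
  exists e : (cyc_AK_Ky -> Ky) -> cyc_AK_Ky,
    (forall chi, irr_characters chi -> attached_idempotent chi (e chi)) /\
    ([set cyc_incl b | b in [set b | primitive_central_idempotent b]] =
      [set \sum_(chi \in B) e chi | B in P])%classic.

Definition same_rouquier_block (psi psi' : cyc_AK_Ky -> Ky) : Prop :=
  exists P B, [/\ rouquier_partition P, P B, B psi & B psi'].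

End Specialized.

Definition Ky_eval (P : {poly K}) (z : Ky) : Ky := (map_poly Kyc P).[z].

(* The order at q = 0 and the degree of a Laurent polynomial f in q = y^w. *)
Definition has_val_q (w : nat) (f : Ky) (a : int) : Prop :=
  let q := Kyy ^+ w in
  exists P : {poly K}, P`_0 != 0 /\ f = q ^ a * Ky_eval P q.

Definition has_deg_q (w : nat) (f : Ky) (A : int) : Prop :=
  let q := Kyy ^+ w in
  exists (P : {poly K}) (k : int),
    [/\ P != 0, f = q ^ k * Ky_eval P q & A = k + (size P).-1%:Z].

End Cyclotomic.

Arguments RK_incl {K zeta}.

(* Main.v *)
(* At x = 1 the elements L_k = t_{k-1} ... t_1 s t_1 ... t_{k-1} are conjugates of
   s, commute with each other and are permuted by the t_j, which square to 1.  Since N = 0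
   is the only essential hyperplane containing the parameters, all differences
   u_a - u_b are units of R_K(y), so Lagrange interpolation in the L_k gives orthogonal
   idempotents E_c over R_K(y), indexed by the maps c from {1, ..., r} to the set of
   components.  The sum of the E_c over all c with prescribed fibre sizes is central,
   and it acts on the Specht module of lambda by 1 or 0 according to whether the fibre
   sizes are the |lambda^(a)|.  Hence these sizes are constant on Rouquier blocks.

   On the other hand the factors x - 1 cancel in the formula for the Schur element, and
   phi(s_lambda) is a nonzero constant times
     (u_0 ... u_{d-1})^{-r} prod_a u_a^{|lambda^(a)|}
                            prod_{a <> b} (u_a - u_b)^{|lambda^(a)|},
   so its valuation and degree only depend on the sizes |lambda^(a)|. *)
From HB Require Import structures.
Require Import Defs.
From mathcomp Require Import all_boot all_order all_algebra all_field.
From mathcomp Require Import ring_quotient mpoly.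
From mathcomp Require Import boolp classical_sets functions cardinality fsbigop.
From mathcomp Require Import fingroup perm zify ring.

Set Implicit Arguments.
Unset Strict Implicit.
Unset Printing Implicit Defensive.

Import Order.TTheory GRing.Theory Num.Theory.
Local Open Scope ring_scope.

(** * Words in the generators at x = 1 *)

Section CommutingProducts.
Variable B : nzRingType.

Lemma prodr_perm_comm (I : eqType) (F : I -> B) (s1 s2 : seq I) :
  (forall i j, F i * F j = F j * F i) -> perm_eq s1 s2 ->
  \prod_(i <- s1) F i = \prod_(i <- s2) F i.
Proof.
move=> Fcomm; elim: s1 s2 => [|x s1 IHs] s2.
  by rewrite perm_sym => /perm_nilP ->.
move=> eq_s; have x_s2 : x \in s2 by rewrite -(perm_mem eq_s) mem_head.
case/splitPr: x_s2 eq_s => u v eq_s.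
have /IHs eq_s1 : perm_eq s1 (u ++ v).
  by rewrite -(perm_cons x) (perm_trans eq_s) // perm_catC /= perm_cons perm_catC.
rewrite big_cons big_cat big_cons eq_s1 big_cat /= !mulrA; congr (_ * _).
by apply: commr_prod => i _; apply: Fcomm.
Qed.

End CommutingProducts.

Section TypeBWords.
Variables (B : nzRingType) (N : nat) (s : B) (t : nat -> B).
Hypothesis tt : forall j, (j < N)%N -> t j * t j = 1.
Hypothesis braid_t : forall j, (j.+1 < N)%N ->
  t j * t j.+1 * t j = t j.+1 * t j * t j.+1.
Hypothesis comm_t : forall i j, (i.+1 < j)%N -> (j < N)%N -> t i * t j = t j * t i.
Hypothesis comm_st : forall j, (0 < j)%N -> (j < N)%N -> s * t j = t j * s.
Hypothesis braid_st : (0 < N)%N -> s * t 0%N * s * t 0%N = t 0%N * s * t 0%N * s.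

Lemma comm_t_far i j : (i < N)%N -> (j < N)%N -> (i.+1 < j)%N || (j.+1 < i)%N ->
  t i * t j = t j * t i.
Proof. by move=> iN jN /orP[] h; [exact: comm_t | symmetry; exact: comm_t]. Qed.

Fixpoint jm (k : nat) : B := if k is k'.+1 then t k' * jm k' * t k' else s.

(** The braid relation moves [a] through [b * a] on the left, where it becomes [b]; this passes [l],
    and a second braid relation turns it back into [a] on the right. *)
Lemma braid_conj (a b l : B) : a * b * a = b * a * b -> b * l = l * b ->
  a * (b * (a * l * a) * b) = b * (a * l * a) * b * a.
Proof.
move=> ab bl; rewrite !mulrA ab -(mulrA (b * a) b l) bl.
by rewrite -!mulrA (mulrA b a b) -ab !mulrA.
Qed.

Lemma comm_conj (a b l : B) : a * b = b * a -> a * l = l * a ->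
  a * (b * l * b) = b * l * b * a.
Proof. by move=> ab al; rewrite !mulrA ab -(mulrA b) al -!mulrA ab. Qed.

Lemma jm_comm_t j k : (j < N)%N -> (k <= N)%N -> j <> k -> j.+1 <> k ->
  t j * jm k = jm k * t j.
Proof.
elim/ltn_ind: k j => -[|k] IH j jN kN jk j1k /=.
  by rewrite comm_st //; lia.
(* For [k = j.+1] the element is [t j.+1 * (t j * jm j * t j) * t j.+1], the pattern of
   [braid_conj]; otherwise the outer letter [t k] is far from [t j] and induction applies. *)
have [jk'|jk'] := eqVneq k j.+1.
  subst k; apply: braid_conj; first exact: braid_t.
  by apply: IH => //; lia.
by apply: comm_conj; [apply: comm_t_far; lia | apply: IH; lia].
Qed.

(** Induction peels off the outer letters of [jm i], which commute with [jm j] since [j] is larger.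
    In the base case the relation [braid_st] gives commutation of [s] with [jm 1], and all further
    letters of [jm j] commute with [s]. *)
Lemma jm_comm_lt i j : (i < j)%N -> (j <= N)%N -> jm i * jm j = jm j * jm i.
Proof.
elim: i j => [|i IH] j ij jN.
  elim: j ij jN => // -[|j] IHj _ jN.
    by rewrite /= !mulrA braid_st.
  by apply: (comm_conj (a := s)); [apply: comm_st; lia | apply: IHj; lia].
by apply/esym/comm_conj; apply/esym; [apply: jm_comm_t; lia | apply: IH; lia].
Qed.

Lemma jm_comm i j : (i <= N)%N -> (j <= N)%N -> jm i * jm j = jm j * jm i.
Proof.
move=> iN jN; have [ij|ij|->//] := ltngtP i j; first exact: jm_comm_lt.
by symmetry; apply: jm_comm_lt.
Qed.

Lemma jm_conj_down j : (j < N)%N -> t j * jm j.+1 * t j = jm j.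
Proof. by move=> jN; rewrite /= !mulrA tt // mul1r -mulrA tt // mulr1. Qed.

Lemma jm_conj_other j k : (j < N)%N -> (k <= N)%N -> j <> k -> j.+1 <> k ->
  t j * jm k * t j = jm k.
Proof. by move=> jN kN jk j1k; rewrite jm_comm_t // -mulrA tt // mulr1. Qed.

(* [dword n i] is t_{n-1} ... t_i, so that the products
   [dword 1 i_1 * ... * dword N i_N] are the usual normal forms of the elements of
   the symmetric group. *)
Definition dword (n i : nat) : B := \prod_(j <- rev (iota i (n - i))) t j.

Fixpoint nforms (n : nat) : seq B :=
  if n is n'.+1 then [seq w * dword n i | w <- nforms n', i <- iota 0 n.+1]
  else [:: 1].

Lemma dwordnn n : dword n n = 1.
Proof. by rewrite /dword subnn big_nil. Qed.

Lemma dwordS n i : (i <= n)%N -> dword n.+1 i = t n * dword n i.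
Proof.
by move=> i_n; rewrite /dword subSn // -addn1 iotaD rev_cat big_cat /= big_seq1 subnKC.
Qed.

Lemma dword_rec n i : (i < n)%N -> dword n i = dword n i.+1 * t i.
Proof.
move=> i_n; rewrite /dword -(subnSK i_n) /= rev_cons -cats1 big_cat /=.
by rewrite big_seq1.
Qed.

Lemma dword_comm_low n i j : (n <= N)%N -> (j.+1 < i)%N -> (i <= n)%N ->
  dword n i * t j = t j * dword n i.
Proof.
move=> nN ji; elim: n nN => [|n IH] nN; first by case: i ji.
rewrite leq_eqVlt => /orP[/eqP->|i_n]; first by rewrite dwordnn mul1r mulr1.
rewrite dwordS // -mulrA IH ?(ltnW nN) // !mulrA; congr (_ * _).
by apply: comm_t_far; lia.
Qed.

Lemma dword_comm_high n i j : (n < j)%N -> (j < N)%N ->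
  dword n i * t j = t j * dword n i.
Proof.
move=> nj jN; apply/esym; rewrite /dword big_seq; apply: commr_prod => k.
by rewrite mem_rev mem_iota => kn; apply: comm_t_far; lia.
Qed.

(** [t j.+1] passes the lower letters of the word, meets [t j.+1 * t j] in a braid relation, and
    leaves as [t j] past the higher letters. *)
Lemma dword_shift n i j : (n <= N)%N -> (i <= j)%N -> (j.+1 < n)%N ->
  dword n i * t j.+1 = t j * dword n i.
Proof.
move=> nN ij; elim: n nN => [|n IH] nN // jn.
rewrite dwordS; last by lia.
have [jn'|jn'] := eqVneq n j.+1; last first.
  rewrite -mulrA IH; try lia.
  by rewrite !mulrA; congr (_ * _); apply: comm_t_far; lia.
subst n; rewrite dwordS // -!mulrA dword_comm_high //.
by rewrite !mulrA braid_t.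
Qed.

Lemma nforms1 n : 1 \in nforms n.
Proof.
elim: n => [|n IH]; first by rewrite inE.
apply/allpairsP; exists (1, n.+1); split; rewrite ?mem_iota //=.
by rewrite dwordnn mulr1.
Qed.

(** Let the last factor be the word ending in [t i]. A letter [t j] with [i < j] passes it as
    [t j.-1], and one with [j.+1 < i] passes it unchanged; both are absorbed by the shorter normal
    form. For [j = i] the last letter is deleted, and for [j.+1 = i] a letter is appended. *)
Lemma nforms_mulr n j w : (n <= N)%N -> (j < n)%N ->
  w \in nforms n -> w * t j \in nforms n.
Proof.
elim: n j w => // n IH j w nN jn /allpairsP[[v i]]; rewrite mem_iota.
rewrite -[(v, i).1]/v -[(v, i).2]/i => -[vn i_n ->]; apply/allpairsP; rewrite -mulrA.
have [ij|ij] := leqP i j.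
  have [eij|nij] := eqVneq i j; last first.
    case: j jn ij nij => [|j] jn ij nij; first by lia.
    exists (v * t j, i); split; rewrite ?mem_iota //=; last first.
      by rewrite dword_shift //; [rewrite mulrA | lia].
    by apply: IH => //; lia.
  subst i; exists (v, j.+1); split; rewrite ?mem_iota //=.
  by rewrite dword_rec // -!mulrA tt ?mulr1 //; lia.
have [eij|nij] := eqVneq i j.+1.
  subst i; exists (v, j); split; rewrite ?mem_iota //=; first by lia.
  by rewrite (dword_rec (i := j)) //.
exists (v * t j, i); split; rewrite ?mem_iota //=.
  by apply: IH => //; lia.
by rewrite dword_comm_low ?mulrA //; lia.
Qed.

End TypeBWords.

(** * Idempotents by Lagrange interpolation *)

Section ProductIdempotents.
Variables (B : nzRingType) (I A : finType) (e : I -> A -> B).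
Hypothesis e_comm : forall i j a b, e i a * e j b = e j b * e i a.
Hypothesis e_orth : forall i a b, a != b -> e i a * e i b = 0.
Hypothesis e_sum : forall i, \sum_a e i a = 1.

Definition pidem (c : {ffun I -> A}) : B := \prod_i e i (c i).

Lemma sum_pidem : \sum_c pidem c = 1.
Proof. by rewrite /pidem -bigA_distr_bigA /= big1. Qed.

Lemma pidem_orth c c' : c != c' -> pidem c * pidem c' = 0.
Proof.
move=> cc'; rewrite -prodrM_comm => [|i j _ _]; last exact: e_comm.
have [i ci] : exists i, c i != c' i.
  by apply/existsP; apply: contraNT cc'; rewrite negb_exists => /forallP eqc;
     apply/eqP/ffunP => i; apply/eqP; have := eqc i; rewrite negbK.
have := mem_index_enum i; elim: (index_enum I) => // j r IH.
rewrite inE big_cons => /orP[/eqP <-|/IH->]; first by rewrite e_orth ?mul0r.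
by rewrite mulr0.
Qed.

Definition sidem (P : pred {ffun I -> A}) : B := \sum_(c | P c) pidem c.

Lemma sidem_add P : sidem P + sidem (predC P) = 1.
Proof. by rewrite -sum_pidem (bigID P). Qed.

Lemma sidem_orth P : sidem P * sidem (predC P) = 0.
Proof.
rewrite mulr_suml big1 // => c Pc; rewrite mulr_sumr big1 // => c' Pc'.
by apply: pidem_orth; apply: contraNneq Pc' => <-.
Qed.

Lemma sidem_idem P : sidem P * sidem P = sidem P.
Proof.
by rewrite -[RHS]mulr1 -(sidem_add P) mulrDr sidem_orth addr0.
Qed.

Lemma comm_sidem x P : (forall i a, x * e i a = e i a * x) ->
  x * sidem P = sidem P * x.
Proof.
by move=> xe; apply: commr_sum => c _; apply: commr_prod => i _; apply: xe.
Qed.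

Section Conjugation.
Variables (t : B) (p : I -> I).
Hypothesis tt : t * t = 1.
Hypothesis pK : involutive p.
Hypothesis te : forall i a, t * e i a * t = e (p i) a.

(** Inserting [t * t = 1] between consecutive factors turns the conjugate of the product into the
    product of the conjugates, whose indices are permuted by [p]. *)
Lemma pidem_conj (c : {ffun I -> A}) : t * pidem c * t = pidem [ffun i => c (p i)].
Proof.
have -> : t * pidem c * t = \prod_i (t * e i (c i) * t).
  rewrite /pidem; elim: (index_enum I) => [|j r IH].
    by rewrite !big_nil mulr1 tt.
  by rewrite !big_cons -IH !mulrA -(mulrA _ t t) tt mulr1.
transitivity (\prod_(i <- map p (index_enum I)) e i (c (p i))).
  by rewrite big_map; apply: eq_bigr => i _; rewrite te pK.
rewrite (prodr_perm_comm (s2 := index_enum I)); first by apply: eq_bigr => i _;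
  rewrite ffunE.
- by move=> i j; apply: e_comm.
- apply: uniq_perm; rewrite ?index_enum_uniq //.
    by rewrite map_inj_uniq ?index_enum_uniq //; apply: inv_inj.
  move=> i; rewrite mem_index_enum; apply/mapP; by exists (p i); rewrite ?pK.
Qed.

Lemma pidem_mulr c : pidem c * t = t * pidem [ffun i => c (p i)].
Proof. by rewrite -pidem_conj !mulrA tt mul1r. Qed.

Lemma comm_sidem_conj (P : pred {ffun I -> A}) :
  (forall c : {ffun I -> A}, P [ffun i => c (p i)] = P c) -> t * sidem P = sidem P * t.
Proof.
move=> Pp; rewrite mulr_suml mulr_sumr.
pose h (c : {ffun I -> A}) : {ffun I -> A} := [ffun i => c (p i)].
have hK : involutive h by move=> c; apply/ffunP => i; rewrite !ffunE pK.
rewrite (reindex_inj (inv_inj hK)); apply: eq_big => [c|c _]; first exact: Pp.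
by rewrite pidem_mulr.
Qed.

End Conjugation.
End ProductIdempotents.

Section LagrangeIdempotents.
Variables (R : comNzRingType) (F : fieldType) (f : {rmorphism R -> F}).
Hypothesis f_inj : injective f.
Variables (d : nat) (u : 'I_d.+1 -> R) (v : 'I_d.+1 -> 'I_d.+1 -> R).
Hypothesis uv : forall a b, a != b -> (u a - u b) * v a b = 1.

(** [kappa a *: ell a] is the Lagrange polynomial of the node [u a]. The inverses of the differences
    of nodes are supplied by [v] because [R] need not be a field. *)
Definition kappa a : R := \prod_(b | b != a) v a b.
Definition ell a : {poly R} := \prod_(b | b != a) ('X - (u b)%:P).

Lemma ell_orth a b : a != b ->
  ell a * ell b = \prod_(c | (c != a) && (c != b)) ('X - (u c)%:P)
                  * \prod_c ('X - (u c)%:P).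
Proof.
move=> ab; set Q := \prod_(c | _ && _) _.
have -> : \prod_c ('X - (u c)%:P) = ('X - (u b)%:P) * ell b by rewrite (bigD1 b).
have -> : ell a = ('X - (u b)%:P) * Q.
  by rewrite /ell (bigD1 (P := fun c => c != a) b) 1?eq_sym.
by rewrite mulrA [Q * _]mulrC.
Qed.

Lemma ell_horner a b : (kappa a *: ell a).[u b] = (a == b)%:R.
Proof.
rewrite hornerZ horner_prod; have [<-|ab] := eqVneq a b.
  rewrite -big_split /= big1 // => c ca.
  by rewrite hornerXsubC mulrC uv // eq_sym.
by rewrite (bigD1 (P := fun c => c != a) b) 1?eq_sym //= hornerXsubC subrr mul0r mulr0.
Qed.

Lemma size_ell a : size (ell a) = d.+1.
Proof.
rewrite /ell -big_filter size_prod_XsubC size_filter.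
by rewrite -sum1_count sum1_card cardC1 card_ord.
Qed.

(** The difference of the two sides has degree at most [d] and vanishes at the [d.+1] distinct
    nodes. Roots are counted in the field [F], into which [R] embeds. *)
Lemma ell_sum : \sum_a kappa a *: ell a = 1.
Proof.
apply/eqP; rewrite -subr_eq0; set G := _ - 1.
have szG : (size G <= d.+1)%N.
  rewrite (leq_trans (size_polyD _ _)) // size_polyN size_poly1 geq_max andbT.
  apply: (leq_trans (size_sum _ _ _)); apply/bigmax_leqP => a _.
  by rewrite (leq_trans (size_scale_leq _ _)) ?size_ell.
have Gu b : G.[u b] = 0.
  rewrite hornerD hornerN hornerC horner_sum (bigD1 b) //= ell_horner eqxx.
  by rewrite big1 ?addr0 ?subrr // => a ab; rewrite ell_horner (negPf ab).
have u_inj : injective (f \o u).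
  move=> a b /f_inj uab; apply/eqP/negPn/negP => /uv.
  by rewrite uab subrr mul0r => /esym/eqP; rewrite oner_eq0.
rewrite -(inj_eq (map_inj_poly f_inj (rmorph0 f))) rmorph0.
apply/negPn/negP => nz.
have := max_poly_roots nz (rs := [seq f (u a) | a <- enum 'I_d.+1]).
rewrite size_map size_enum_ord (size_map_inj_poly f_inj (rmorph0 f)) ltnNge szG /=.
move=> H; have //: false; apply: H; last by rewrite (map_inj_uniq u_inj) enum_uniq.
by apply/allP => _ /mapP[a _ ->]; rewrite rootE horner_map Gu rmorph0.
Qed.

Section Algebra.
Variables (H : algType R) (r : nat) (L : 'I_r -> H).
Hypothesis L_comm : forall i j, L i * L j = L j * L i.
Hypothesis L_min : forall i, horner_alg (L i) (\prod_c ('X - (u c)%:P)) = 0.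

Definition lidem i a : H := kappa a *: horner_alg (L i) (ell a).

Lemma comm_horner_alg (x y : H) p : x * y = y * x ->
  x * horner_alg y p = horner_alg y p * x.
Proof.
move=> xy; elim/poly_ind: p => [|p c IH]; first by rewrite rmorph0 mulr0 mul0r.
rewrite rmorphD rmorphM /= horner_algX horner_algC mulrDr mulrDl mulrA IH.
by rewrite -!mulrA xy; congr (_ + _); rewrite -scalerAr -scalerAl mulr1 mul1r.
Qed.

Lemma comm_lidem x i a : x * L i = L i * x -> x * lidem i a = lidem i a * x.
Proof. by move=> xL; rewrite -scalerAr comm_horner_alg // scalerAl. Qed.

Lemma lidem_comm i j a b : lidem i a * lidem j b = lidem j b * lidem i a.
Proof. by apply/comm_lidem/esym/comm_lidem. Qed.

(** For distinct [a] and [b] the product of the Lagrange polynomials is a multiple of the full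
    product over the nodes, which annihilates [L i]. *)
Lemma lidem_orth i a b : a != b -> lidem i a * lidem i b = 0.
Proof.
move=> ab; rewrite -scalerAl -scalerAr -rmorphM ell_orth // rmorphM /= L_min.
by rewrite mulr0 !scaler0.
Qed.

Lemma lidem_sum i : \sum_a lidem i a = 1.
Proof.
transitivity (horner_alg (L i) (\sum_a kappa a *: ell a)); last first.
  by rewrite ell_sum rmorph1.
by rewrite linear_sum; apply: eq_bigr => a _; rewrite linearZ /= mulr_algl.
Qed.

Lemma horner_alg_conj (t x : H) p : t * t = 1 ->
  t * horner_alg x p * t = horner_alg (t * x * t) p.
Proof.
move=> tt; elim/poly_ind: p => [|p c IH]; first by rewrite !rmorph0 mulr0 mul0r.
rewrite !rmorphD !rmorphM /= !horner_algX !horner_algC mulrDr mulrDl -IH.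
congr (_ + _); last by rewrite -scalerAr mulr1 -scalerAl tt.
by rewrite !mulrA -(mulrA _ t t) tt mulr1.
Qed.

Lemma lidem_conj (t : H) i j a : t * t = 1 -> t * L i * t = L j ->
  t * lidem i a * t = lidem j a.
Proof.
by move=> tt tL; rewrite -scalerAr -scalerAl horner_alg_conj // tL.
Qed.

Lemma lidem_eigen i a : L i * lidem i a = u a *: lidem i a.
Proof.
have : (L i - (u a)%:A) * horner_alg (L i) (ell a) = 0.
  rewrite -(L_min i) (bigD1 a) //= rmorphM /= rmorphB /= horner_algX horner_algC.
  by [].
move/eqP; rewrite mulrBl subr_eq0 -scalerAl mul1r => /eqP eL.
by rewrite -scalerAr eL !scalerA mulrC.
Qed.

Lemma lidem_prod i a :
  lidem i a = kappa a *: \prod_(b | b != a) (L i - (u b)%:A).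
Proof.
congr (_ *: _); rewrite rmorph_prod; apply: eq_bigr => b _.
by rewrite rmorphB /= horner_algX horner_algC.
Qed.

End Algebra.
End LagrangeIdempotents.

(** * The Ariki-Koike algebra at x = 1 *)

Section Span.
Variables (R : comNzRingType) (H : algType R) (S : seq H).

Definition in_span (a : H) : Prop :=
  exists k : 'I_(size S) -> R, a = \sum_i k i *: S`_i.

Lemma in_span0 : in_span 0.
Proof. by exists (fun=> 0); rewrite big1 // => i _; rewrite scale0r. Qed.

Lemma in_spanD a b : in_span a -> in_span b -> in_span (a + b).
Proof.
move=> [k ->] [l ->]; exists (fun i => k i + l i); rewrite -big_split /=.
by apply: eq_bigr => i _; rewrite scalerDl.
Qed.

Lemma in_spanZ c a : in_span a -> in_span (c *: a).
Proof.
move=> [k ->]; exists (fun i => c * k i); rewrite scaler_sumr.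
by apply: eq_bigr => i _; rewrite scalerA.
Qed.

Lemma in_span_sum (I : Type) (r : seq I) (P : pred I) (h : I -> H) :
  (forall i, P i -> in_span (h i)) -> in_span (\sum_(i <- r | P i) h i).
Proof. by apply: big_ind; [exact: in_span0 | exact: in_spanD]. Qed.

Lemma mem_in_span a : a \in S -> in_span a.
Proof.
move=> aS; have i_lt : (index a S < size S)%N by rewrite index_mem.
exists (fun i => (i == Ordinal i_lt)%:R); rewrite (bigD1 (Ordinal i_lt)) //=.
rewrite eqxx scale1r nth_index // big1 ?addr0 // => i /negPf->.
by rewrite scale0r.
Qed.

Lemma in_span_mulr y : {in S, forall a, in_span (a * y)} ->
  forall a, in_span a -> in_span (a * y).
Proof.
move=> Sy a [k ->]; rewrite mulr_suml; apply: in_span_sum => i _.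
by rewrite -scalerAl; apply/in_spanZ/Sy/mem_nth.
Qed.

End Span.

(** With more idempotents than elements of [S], the coefficient matrix has a nonzero left kernel;
    multiplying the resulting linear relation by [e i] isolates its [i]-th coefficient, which
    therefore vanishes. *)
Lemma orthogonal_idempotents_bound (F : fieldType) (H : algType F) (S : seq H)
    (n : nat) (e : 'I_n -> H) :
  (forall a, in_span S a) -> (forall i, e i != 0) -> (forall i, e i * e i = e i) ->
  (forall i j, i != j -> e i * e j = 0) -> (n <= size S)%N.
Proof.
move=> Sall e0 ee eo; have /choice[k ke] := fun i => Sall (e i).
pose M := \matrix_(i, j) k i j; rewrite leqNgt; apply/negP => ltSn.
have /rowV0Pn[x /sub_kermxP xM /negP] : kermx M != 0.
  rewrite kermx_eq0 /row_free neq_ltn; apply/orP; left.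
  by rewrite (leq_ltn_trans (rank_leq_col M)).
apply; apply/eqP/rowP => i; rewrite mxE.
have xe : \sum_j x 0 j *: e j = 0.
  transitivity (\sum_j (x *m M) 0 j *: S`_j); last first.
    by rewrite xM big1 // => j _; rewrite mxE scale0r.
  under [RHS]eq_bigr => j _ do rewrite mxE scaler_suml.
  rewrite exchange_big /=; apply: eq_bigr => j _; rewrite {1}ke scaler_sumr.
  by apply: eq_bigr => l _; rewrite mxE scalerA.
have /eqP := congr1 (fun z => e i * z) xe; rewrite mulr0 mulr_sumr (bigD1 i) //=.
rewrite -scalerAr ee big1 => [|j ji]; last by rewrite -scalerAr eo ?scaler0 1?eq_sym.
by rewrite addr0 scaler_eq0 (negPf (e0 i)) orbF => /eqP.
Qed.

Section RawJucysMurphy.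
Variables (R : comNzRingType) (d r : nat) (u : 'I_d.+1 -> R) (x : R).

(** The Jucys-Murphy element without the power of [x], so that it makes sense over every base ring
    and is compatible with base change. *)
Definition raw_jm (k : nat) : AK r u x :=
  let js := take k (enum 'I_r.-1) in
  (\prod_(j <- rev js) AK_t j) * AK_s * \prod_(j <- js) AK_t j.

(** The generators indexed by all natural numbers, as the lemmas on words expect; the value out of
    range is 1. *)
Definition tn (j : nat) : AK r u x := if insub j is Some o then AK_t o else 1.

Lemma tn_ord (o : 'I_r.-1) : tn o = AK_t o.
Proof. by rewrite /tn valK. Qed.

Lemma raw_jmE k : (k <= r.-1)%N -> raw_jm k = jm AK_s tn k.
Proof.
have -> : raw_jm k = (\prod_(j <- rev (take k (iota 0 r.-1))) tn j) * AK_s *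
    \prod_(j <- take k (iota 0 r.-1)) tn j.
  rewrite -val_enum_ord -map_take -map_rev !big_map.
  by congr (_ * _ * _); apply: eq_bigr => o _; rewrite tn_ord.
move=> kr; rewrite take_iota (minn_idPl kr); elim: k {kr} => [|k IH].
  by rewrite /= !big_nil mul1r mulr1.
rewrite -addn1 iotaD rev_cat !big_cat /= !big_seq1 add0n addn1 /= -IH.
by rewrite !mulrA.
Qed.

Lemma AK_central (a : AK r u x) : a * AK_s = AK_s * a ->
  (forall j, a * AK_t j = AK_t j * a) -> forall b, a * b = b * a.
Proof.
move=> aS aT b; rewrite -(AK_evalE b).
elim: (AKrepr b) => /= [|j|c|e1 IH1 e2 IH2|e1 IH1 e2 IH2] //.
- by rewrite -scalerAr -scalerAl mulr1 mul1r.
- by rewrite mulrDl mulrDr IH1 IH2.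
- by rewrite mulrA IH1 -mulrA IH2 mulrA.
Qed.
End RawJucysMurphy.

Lemma AK_map_raw_jm (R S : comNzRingType) (f : {rmorphism R -> S}) d r
  (u : 'I_d.+1 -> R) x k :
  AK_map f (raw_jm r u x k) = raw_jm r (fun j => f (u j)) (f x) k.
Proof.
rewrite /raw_jm !rmorphM !rmorph_prod /= AK_map_s.
by congr (_ * _ * _); apply: eq_bigr => j _; rewrite AK_map_t.
Qed.

Section AtOne.
Variables (R : comNzRingType) (F : fieldType) (f : {rmorphism R -> F}).
Hypothesis f_inj : injective f.
Variables (d r : nat) (u : 'I_d.+1 -> R) (v : 'I_d.+1 -> 'I_d.+1 -> R) (x : R).
Hypotheses (r_gt0 : (0 < r)%N) (x1 : x = 1).
Hypothesis uv : forall a b, a != b -> (u a - u b) * v a b = 1.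

Local Notation H := (AK r u x).
Local Notation t := (tn r u x).
Let Hrel := AK_gen_relations r u x.

Lemma ltn_predr k : (k < r)%N = (k <= r.-1)%N.
Proof. by rewrite -[in RHS]ltnS prednK. Qed.

Lemma tn_insub j (jr : (j < r.-1)%N) : t j = AK_t (Ordinal jr).
Proof. exact: (tn_ord u x (Ordinal jr)). Qed.

Lemma AK_t_sq o : AK_t o * AK_t o = 1 :> H.
Proof.
have := AK_quad_t Hrel o; rewrite x1 scale1r mulrDr mulr1 mulrBl mul1r.
by rewrite addrA subrK => /eqP; rewrite subr_eq0 => /eqP.
Qed.

Lemma tn_sq j : (j < r.-1)%N -> t j * t j = 1.
Proof. by move=> jr; rewrite tn_insub AK_t_sq. Qed.

Lemma tn_braid j : (j.+1 < r.-1)%N -> t j * t j.+1 * t j = t j.+1 * t j * t j.+1.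
Proof.
move=> jr; rewrite (tn_insub jr) (tn_insub (ltnW jr)).
exact: (AK_braid_tt Hrel).
Qed.

Lemma tn_comm i j : (i.+1 < j)%N -> (j < r.-1)%N -> t i * t j = t j * t i.
Proof.
move=> ij jr; have ir : (i < r.-1)%N by lia.
by rewrite (tn_insub jr) (tn_insub ir); apply: (AK_comm_tt Hrel).
Qed.

Lemma tn_comm_s j : (0 < j)%N -> (j < r.-1)%N -> AK_s * t j = t j * AK_s.
Proof.
by move=> j0 jr; rewrite (tn_insub jr); apply: (AK_comm_st Hrel) => /=; lia.
Qed.

Lemma tn_braid_s : (0 < r.-1)%N ->
  AK_s * t 0%N * AK_s * t 0%N = t 0%N * AK_s * t 0%N * AK_s.
Proof. by move=> r0; rewrite (tn_insub r0); apply: (AK_braid_st Hrel). Qed.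

Let L (i : 'I_r) : H := raw_jm r u x i.

Lemma raw_jm_ord (i : 'I_r) : L i = jm AK_s t i.
Proof. by apply: raw_jmE; rewrite -ltn_predr. Qed.

Lemma raw_jm_comm (i j : 'I_r) : L i * L j = L j * L i.
Proof.
rewrite !raw_jm_ord; apply: (jm_comm tn_braid tn_comm tn_comm_s tn_braid_s);
  by rewrite -ltn_predr.
Qed.

(** The generator [AK_s] satisfies this equation by its defining relation, and conjugation by the
    involutions [t] preserves it. *)
Lemma raw_jm_min (i : 'I_r) : horner_alg (L i) (\prod_c ('X - (u c)%:P)) = 0.
Proof.
rewrite raw_jm_ord; case: i => /= i; rewrite ltn_predr.
elim: i => [_|i IH i_r] /=.
  rewrite -[RHS](AK_quad_s Hrel) rmorph_prod; apply: eq_bigr => a _.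
  by rewrite rmorphB /= horner_algX horner_algC.
by rewrite -horner_alg_conj ?tn_sq // IH ?mulr0 ?mul0r // ltnW.
Qed.

Section Swap.
Variable o : 'I_r.-1.
Fact swap_subproof0 : (o < r)%N. Proof. by rewrite ltn_predr ltnW. Qed.
Fact swap_subproof1 : (o.+1 < r)%N. Proof. by rewrite ltn_predr. Qed.
Definition swap : 'I_r -> 'I_r :=
  tperm (Ordinal swap_subproof0) (Ordinal swap_subproof1).

Lemma swapK : involutive swap.
Proof. exact: tpermK. Qed.

Lemma raw_jm_conj i : AK_t o * L i * AK_t o = L (swap i).
Proof.
rewrite !raw_jm_ord -tn_ord /swap; case: tpermP => [->|->|i0 i1].
- by [].
- exact: (jm_conj_down _ tn_sq).
- apply: (jm_conj_other tn_sq tn_braid tn_comm tn_comm_s tn_braid_s) => //.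
  + by rewrite -ltn_predr.
  + by move=> oi; apply: i0; apply: val_inj.
  + by move=> oi; apply: i1; apply: val_inj.
Qed.
End Swap.

Definition jm_idem (i : 'I_r) (a : 'I_d.+1) : H := lidem u v L i a.

Let e_comm i j a b : jm_idem i a * jm_idem j b = jm_idem j b * jm_idem i a.
Proof. by apply: lidem_comm => *; apply: raw_jm_comm. Qed.
Let e_orth i a b : a != b -> jm_idem i a * jm_idem i b = 0.
Proof. by move=> ab; apply: lidem_orth => // *; apply: raw_jm_min. Qed.
Let e_sum i : \sum_a jm_idem i a = 1.
Proof. exact: (lidem_sum f_inj uv). Qed.

Definition type_idem (P : pred {ffun 'I_r -> 'I_d.+1}) : H := sidem jm_idem P.

Lemma raw_jm0 : L (Ordinal r_gt0) = AK_s.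
Proof. by rewrite raw_jm_ord. Qed.

Lemma AK_s_comm_jm i a : AK_s * jm_idem i a = jm_idem i a * AK_s.
Proof. by rewrite -raw_jm0; apply: comm_lidem; apply: raw_jm_comm. Qed.

(** [AK_s] is the first Jucys-Murphy element, hence commutes with all the interpolation idempotents.
    Conjugation by [AK_t o] swaps two indices, which only permutes the maps [c] satisfying [P]. *)
Lemma type_idem_central (P : pred {ffun 'I_r -> 'I_d.+1}) :
  (forall (p : {perm 'I_r}) (c : {ffun 'I_r -> 'I_d.+1}), P [ffun i => c (p i)] = P c) ->
  forall b, type_idem P * b = b * type_idem P.
Proof.
move=> Pp; apply: AK_central => [|o]; apply/esym.
  by apply: comm_sidem => i a; apply: AK_s_comm_jm.
apply: (comm_sidem_conj e_comm (AK_t_sq o) (@swapK o)) => [i a|c].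
  by apply: lidem_conj; [exact: AK_t_sq | exact: raw_jm_conj].
exact: Pp.
Qed.

Lemma type_idem_central_idempotent (P : pred {ffun 'I_r -> 'I_d.+1}) :
  (forall (p : {perm 'I_r}) (c : {ffun 'I_r -> 'I_d.+1}), P [ffun i => c (p i)] = P c) ->
  central_idempotent (type_idem P).
Proof.
move=> Pp; split; first exact: (sidem_idem e_comm e_orth e_sum).
by move=> a; rewrite type_idem_central.
Qed.

(** Normal forms of the symmetric group times interpolation idempotents. Over a field this finite
    list bounds the number of orthogonal idempotents, hence the size of a block. *)
Definition AK_spanning : seq H :=
  [seq g * pidem jm_idem c | g <- nforms t r.-1, c <- enum {ffun 'I_r -> 'I_d.+1}].

Lemma AK_spanning_mem g c : g \in nforms t r.-1 -> g * pidem jm_idem c \in AK_spanning.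
Proof. by move=> gr; apply: allpairs_f; rewrite ?mem_enum. Qed.

Lemma pidem_eigen c : pidem jm_idem c * AK_s = u (c (Ordinal r_gt0)) *: pidem jm_idem c.
Proof.
rewrite /pidem; set i0 := Ordinal r_gt0; have := mem_index_enum i0.
elim: (index_enum _) => // i l IH; rewrite inE !big_cons => /orP[/eqP <-|/IH el].
  rewrite -mulrA; have -> : \prod_(j <- l) jm_idem j (c j) * AK_s =
      AK_s * \prod_(j <- l) jm_idem j (c j).
    by apply/esym/commr_prod => j _; apply: AK_s_comm_jm.
  rewrite mulrA -AK_s_comm_jm -raw_jm0 [L _ * _]lidem_eigen.
    by rewrite -scalerAl.
  by move=> j; apply: raw_jm_min.
by rewrite -mulrA el -scalerAr.
Qed.

(** The span contains 1, the sum of all [pidem c], and is stable under right multiplication by the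
    generators: [AK_s] scales each [pidem c], while [AK_t o] passes it by changing [c] and is then
    absorbed by the normal form. *)
Lemma AK_spanningP a : in_span AK_spanning a.
Proof.
rewrite -[a]mul1r -(AK_evalE a).
have sp1 : in_span AK_spanning 1.
  rewrite -(sum_pidem e_sum); apply: in_span_sum => c _.
  by apply: mem_in_span; rewrite -[pidem _ _]mul1r AK_spanning_mem ?nforms1.
(* The left factor 1 is generalized to any element of the span, so that the product case can chain
   the two induction hypotheses. *)
elim: (AKrepr a) (1 : H) sp1 => /= [|o|k|e1 IH1 e2 IH2|e1 IH1 e2 IH2] b sb.
- apply: in_span_mulr sb => _ /allpairsP[[g c] /= [gr _ ->]].
  rewrite -mulrA pidem_eigen -scalerAr.
  by apply/in_spanZ/mem_in_span/AK_spanning_mem.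
- apply: in_span_mulr sb => _ /allpairsP[[g c] /= [gr _ ->]].
  rewrite -mulrA (pidem_mulr e_comm (AK_t_sq o) (@swapK o)) => [|i j]; last first.
    by apply: lidem_conj; [exact: AK_t_sq | exact: raw_jm_conj].
  rewrite mulrA; apply/mem_in_span/AK_spanning_mem; rewrite -tn_ord.
  exact: (nforms_mulr tn_sq tn_braid tn_comm).
- by rewrite -scalerAr mulr1; apply: in_spanZ.
- by rewrite mulrDr; apply: in_spanD; [exact: IH1 | exact: IH2].
- by rewrite mulrA; apply/IH2/IH1.
Qed.

End AtOne.

(** * Characters and blocks *)

Lemma central_idempotentM (A : nzRingType) (x y : A) :
  central_idempotent x -> central_idempotent y -> central_idempotent (x * y).
Proof.
move=> [xx xc] [yy yc]; split=> [|a].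
  by rewrite mulrA -(mulrA x y x) -yc mulrA xx -mulrA yy.
by rewrite mulrA xc -!mulrA yc.
Qed.

Lemma central_idempotentC (A : nzRingType) (x : A) :
  central_idempotent x -> central_idempotent (1 - x).
Proof.
move=> [xx xc]; split=> [|a].
  by rewrite mulrBr mulr1 mulrBl mul1r xx subrr subr0.
by rewrite mulrBr mulrBl mulr1 mul1r xc.
Qed.

(** [b] is the sum of the orthogonal central idempotents [b * z] and [b * (1 - z)], one of which
    vanishes by primitivity. *)
Lemma primitive_central_split (A : nzRingType) (b z : A) :
  primitive_central_idempotent b -> central_idempotent z ->
  b * z = 0 \/ b * z = b.
Proof.
move=> [cb b0 bprim] cz; have cz' := central_idempotentC cz.
case: (bprim (b * z) (b * (1 - z))).
- exact: central_idempotentM.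
- exact: central_idempotentM.
- rewrite mulrA -(mulrA b z b) (cb.2 z) mulrA cb.1 -mulrA mulrBr mulr1 cz.1.
  by rewrite subrr mulr0.
- by rewrite mulrBr mulr1 addrC subrK.
- by move=> ->; left.
- by rewrite mulrBr mulr1 => /subr0_eq <-; right.
Qed.

Section Characters.
Variables (F : fieldType) (H : algType F).
Hypothesis F_char0 : forall n, n.+1%:R != 0 :> F.

Lemma irr_character_sum (chi : H -> F) (I : Type) (l : seq I) (P : pred I) (h : I -> H) :
  irr_characters chi -> chi (\sum_(i <- l | P i) h i) = \sum_(i <- l | P i) chi (h i).
Proof.
move=> [n [rho [_ chiE]]]; rewrite chiE rmorph_sum raddf_sum.
by apply: eq_bigr => i _; rewrite chiE.
Qed.

Lemma irr_character1_neq0 (chi : H -> F) : irr_characters chi -> chi 1 != 0.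
Proof. by move=> [n [rho [_ ->]]]; rewrite rmorph1 mxtrace1. Qed.

Variable e : (H -> F) -> H.
Hypothesis e_att : forall chi, irr_characters chi -> attached_idempotent chi (e chi).

(** If the product were nonzero, primitivity would give [e chi = e chi']; this element would act on
    [chi] both as 1 and as 0, forcing [chi 1 = 0], which characteristic 0 excludes. *)
Lemma attached_idempotent_orth chi chi' :
  irr_characters chi -> irr_characters chi' -> chi <> chi' -> e chi * e chi' = 0.
Proof.
move=> ichi ichi' cc'; have [pe chie _] := e_att ichi.
have [pe' _ chie'] := e_att ichi'.
have [ce _ _] := pe; have [ce' _ _] := pe'.
have [//|ee] := primitive_central_split pe ce'.
have [|ee'] := primitive_central_split pe' ce; first by case: ce => _ ->.
have: chi 1 = 0.
  by rewrite -chie -ee (ce'.2 (e chi)) ee'; apply: chie'.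
by move/eqP; rewrite (negPf (irr_character1_neq0 ichi)).
Qed.

(* Rules out infinite blocks, over which [\sum_(chi \in B) e chi] would be the junk
   value 0. *)
Lemma finite_irr_characters (S : seq H) (B : set (H -> F)) :
  (forall a, in_span S a) -> (B `<=` @irr_characters F H)%classic -> finite_set B.
Proof.
move=> Sall Birr; apply: contrapT => /(infinite_set_fset (size S).+1)[l lB sl].
have irr_l i : irr_characters (tnth (in_tuple (finmap.enum_fset l)) i).
  by apply/Birr/lB; apply: mem_tnth.
have := @orthogonal_idempotents_bound F H S _
  (fun i => e (tnth (in_tuple (finmap.enum_fset l)) i)) Sall.
rewrite leqNgt sl => bound; have //: false; apply: bound.
- by move=> i; have [[_ e0 _] _ _] := e_att (irr_l i); apply/eqP.
- by move=> i; have [[[ee _] _ _] _ _] := e_att (irr_l i).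
- move=> i j ij; apply: attached_idempotent_orth => // /eqP.
  rewrite !(tnth_nth (fun=> 0)) nth_uniq ?finmap.fset_uniq //.
  by move/eqP/val_inj/eqP; rewrite (negPf ij).
Qed.

Lemma character_block_sum (B : set (H -> F)) psi a :
  finite_set B -> (B `<=` @irr_characters F H)%classic -> B psi ->
  psi ((\sum_(chi \in B) e chi) * a) = psi a.
Proof.
move=> finB Birr Bpsi; rewrite fsbig_finite // mulr_suml irr_character_sum;
  last exact: Birr.
rewrite (bigD1_seq psi) ?finmap.fset_uniq //=; last first.
  by rewrite in_fset_set //; apply: mem_set.
have [_ -> _] := e_att (Birr _ Bpsi).
rewrite big_seq_cond big1 ?addr0 // => chi /andP[].
rewrite in_fset_set // => /set_mem Bchi chipsi.
have [_ _ ->//] := e_att (Birr _ Bchi); first exact: Birr.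
by move=> psichi; rewrite psichi eqxx in chipsi.
Qed.

End Characters.

Section Block.
Variables (K : fieldType) (zeta : K) (d r : nat) (phi : {rmorphism laurent d -> RK zeta}).
Hypothesis K_char0 : forall n, n.+1%:R != 0 :> K.

Lemma Ky_char0 n : n.+1%:R != 0 :> Ky K.
Proof.
have -> : n.+1%:R = tofrac (n.+1%:R%:P) :> Ky K by rewrite !rmorph_nat.
by rewrite tofrac_eq0 polyC_eq0.
Qed.

Lemma cyc_inclM (a b : cyc_AK_RK r phi) :
  cyc_incl (a * b) = cyc_incl a * cyc_incl b.
Proof. exact: rmorphM. Qed.

(** The sum over the block is the image of a primitive central idempotent [b] over [RK], and it acts
    as 1 on both characters. Now [b * z] is 0 or [b]; the nonzero value of [psi] excludes 0, so
    [psi'] does not distinguish [z] from 1. *)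
Lemma same_block_central_idempotent (S : seq (cyc_AK_Ky r phi)) psi psi' z :
  (forall a, in_span S a) -> same_rouquier_block psi psi' ->
  central_idempotent z -> psi (@cyc_incl _ _ _ r phi z) != 0 ->
  psi' (cyc_incl z) = psi' 1.
Proof.
move=> Sall [P [B [[[Pcov _ _] [e [e_att Pe]]] PB Bpsi Bpsi']]] cz psiz.
have Birr : (B `<=` @irr_characters _ (cyc_AK_Ky r phi))%classic.
  by rewrite -Pcov; apply: bigcup_sup.
have finB := finite_irr_characters Ky_char0 e_att Sall Birr.
have [b bprim be] : [set cyc_incl b | b in
    [set b | @primitive_central_idempotent (cyc_AK_RK r phi) b]]%classic
      (\sum_(chi \in B) e chi) by rewrite Pe; exists B.
have psib a : psi (cyc_incl b * a) = psi a by rewrite be; apply: character_block_sum.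
have psib' a : psi' (cyc_incl b * a) = psi' a by rewrite be; apply: character_block_sum.
have [bz|bz] := primitive_central_split bprim cz.
  move: psiz; rewrite -psib -cyc_inclM bz [cyc_incl 0]rmorph0.
  have [n [rho [_ ->]]] := Birr _ Bpsi.
  by rewrite rmorph0 mxtrace0 eqxx.
by rewrite -psib' -cyc_inclM bz -[RHS]psib' mulr1.
Qed.

End Block.

(** * Character values on the interpolation idempotents *)

Section DiagonalAction.
Variables (F : fieldType) (n : nat) (P : 'M[F]_n.+1).

Definition acts_diagonally (A : 'M[F]_n.+1) (D : 'I_n.+1 -> F) : Prop :=
  P *m A = diag_mx (\row_i D i) *m P.

Lemma acts_diagonallyM A A' D D' : acts_diagonally A D -> acts_diagonally A' D' ->
  acts_diagonally (A * A') (fun i => D i * D' i).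
Proof.
rewrite /acts_diagonally => PA PA';
  rewrite -[A * A']/(A *m A') mulmxA PA -mulmxA PA' mulmxA.
rewrite mulmx_diag; congr (diag_mx _ *m _).
by apply/rowP => i; rewrite !mxE.
Qed.

Lemma acts_diagonally1 : acts_diagonally 1 (fun=> 1).
Proof.
rewrite /acts_diagonally -[1 in LHS]/(1%:M) mulmx1 (_ : \row_i 1 = const_mx 1) ?diag_const_mx ?mul1mx //.
by apply/rowP => i; rewrite !mxE.
Qed.

Lemma acts_diagonally_prod (I : Type) (l : seq I) (Q : pred I) A D :
  (forall i, acts_diagonally (A i) (D i)) ->
  acts_diagonally (\prod_(i <- l | Q i) A i) (fun j => \prod_(i <- l | Q i) D i j).
Proof.
move=> AD; elim: l => [|i l IH].
  rewrite big_nil (_ : (fun j => _) = fun=> 1); first exact: acts_diagonally1.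
  by apply/funext => j; rewrite big_nil.
rewrite big_cons (_ : (fun j => _) = fun j => if Q i then
  D i j * \prod_(k <- l | Q k) D k j else \prod_(k <- l | Q k) D k j).
  by case: ifP => // _; apply: acts_diagonallyM.
by apply/funext => j; rewrite big_cons.
Qed.

Lemma acts_diagonallyZ c A D : acts_diagonally A D ->
  acts_diagonally (c *: A) (fun i => c * D i).
Proof.
rewrite /acts_diagonally => PA; rewrite -scalemxAr PA scalemxAl -linearZ /=.
by congr (diag_mx _ *m _); apply/rowP => i; rewrite !mxE.
Qed.

Lemma acts_diagonallyB A A' D D' : acts_diagonally A D -> acts_diagonally A' D' ->
  acts_diagonally (A - A') (fun i => D i - D' i).
Proof.
rewrite /acts_diagonally => PA PA'; rewrite mulmxBr PA PA' -mulmxBl -linearB /=.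
by congr (diag_mx _ *m _); apply/rowP => i; rewrite !mxE.
Qed.

Lemma acts_diagonally_tr A D : P \in unitmx -> acts_diagonally A D ->
  \tr A = \sum_i D i.
Proof.
move=> Pu PA; rewrite -[A](mulKmx Pu) PA mxtrace_mulC mulmxK // mxtrace_diag.
by apply: eq_bigr => i _; rewrite mxE.
Qed.

End DiagonalAction.

Section GenericVariables.
Variables (d r : nat).

Lemma mpoly_var_neq0 n (i : 'I_n) : 'X_i != 0 :> {mpoly int[n]}.
Proof.
apply/negP => /eqP/(congr1 (meval (fun=> 1))) /eqP.
by rewrite mevalXU rmorph0 oner_eq0.
Qed.

Lemma genx_neq0 : genx d != 0.
Proof. by rewrite tofrac_eq0 mpoly_var_neq0. Qed.

Lemma genx_sub1_neq0 : genx d - 1 != 0.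
Proof.
rewrite -(rmorph1 (@tofrac _)) -[_ - _]rmorphB tofrac_eq0; apply/negP => /eqP.
move/(congr1 (meval (fun=> 0))) => /eqP.
by rewrite rmorphB rmorph1 rmorph0 /= mevalXU sub0r oppr_eq0 oner_eq0.
Qed.

Lemma genu_neq0 (j : 'I_d.+1) : genu j != 0.
Proof. by rewrite tofrac_eq0 mpoly_var_neq0. Qed.

Lemma laurent_incl_inj : injective (@laurent_incl d).
Proof. exact: val_inj. Qed.

Definition lau_xV : laurent d :=
  @in_subring _ (@laurent_gens d) (genx d)^-1 (or_intror (or_intror erefl)).

Lemma lau_xxV : lau_x d * lau_xV = 1.
Proof. by apply: val_inj; rewrite /= divff // genx_neq0. Qed.

(** Lifts the powers of [x] in the eigenvalues to the Laurent ring, where a specialization can be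
    applied; one lift works for every morphism sending [x] to 1. *)
Lemma laurent_genx_exp (z : int) : exists c : laurent d,
  laurent_incl c = genx d ^ z /\
  forall (S : comNzRingType) (phi : {rmorphism laurent d -> S}),
    phi (lau_x d) = 1 -> phi c = 1.
Proof.
have xV (S : comNzRingType) (phi : {rmorphism laurent d -> S}) :
    phi (lau_x d) = 1 -> phi lau_xV = 1.
  by move=> p1; rewrite -[LHS]mul1r -p1 -rmorphM lau_xxV rmorph1.
case: z => k.
  by exists (lau_x d ^+ k); split=> [|S phi p1]; rewrite !rmorphXn ?p1 ?expr1n.
exists (lau_xV ^+ k.+1); split=> [|S phi /xV p1]; last by rewrite rmorphXn p1 expr1n.
by rewrite rmorphXn NegzE /= exprVn.
Qed.

End GenericVariables.

Definition tab_type (d r : nat) (T : {ffun 'I_r -> box d}) : {ffun 'I_r -> 'I_d.+1} :=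
  [ffun k => (T k).1].

Section Specialization.
Variables (K : fieldType) (zeta : K) (d r : nat) (phi : {rmorphism laurent d -> RK zeta}).
Hypothesis phi_x : phi (lau_x d) = 1.
Variable v : 'I_d.+1 -> 'I_d.+1 -> RK zeta.
Local Notation u := (fun j => phi (lau_u j)).
Hypothesis uv : forall a b, a != b -> (u a - u b) * v a b = 1.

(** The product [pidem] stripped of its constants [kappa]. Unlike the idempotent it exists over the
    generic Laurent ring, where the differences of the [u_j] have no inverses, so the specialized
    character can be computed on it from the generic one. *)
Definition jm_prod (R : comNzRingType) (w : 'I_d.+1 -> R) (x : R)
    (c : {ffun 'I_r -> 'I_d.+1}) : AK r w x :=
  \prod_(i < r) \prod_(b | b != c i) (raw_jm r w x i - (w b)%:A).

Lemma AK_map_jm_prod (R S : comNzRingType) (f : {rmorphism R -> S}) w x c :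
  AK_map f (jm_prod w x c) = jm_prod (fun j => f (w j)) (f x) c.
Proof.
rewrite /jm_prod rmorph_prod; apply: eq_bigr => i _.
rewrite rmorph_prod; apply: eq_bigr => b _.
by rewrite rmorphB /= AK_map_raw_jm AK_mapZ rmorph1.
Qed.

Lemma pidem_jm_prod c :
  pidem (jm_idem u v (phi (lau_x d))) c =
  (\prod_i kappa v (c i)) *: cyc_spec phi (jm_prod (@lau_u d) (lau_x d) c).
Proof.
rewrite /cyc_spec AK_map_jm_prod /pidem -scaler_prod; apply: eq_bigr => i _.
exact: lidem_prod.
Qed.

Variables (lam : 'I_d.+1 -> seq nat) (chi : generic_AK_Qux d r -> Qux d).
Variable psi : cyc_AK_Ky r phi -> Ky K.
Hypothesis psiP : specialized_character chi psi.

Lemma psi0 : psi 0 = 0.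
Proof.
by have := psiP.1 (-1) 0 0; rewrite scaler0 addr0 mulN1r addNr.
Qed.

Lemma psiZ k a : psi (k *: a) = k * psi a.
Proof. by have := psiP.1 k a 0; rewrite psi0 !addr0. Qed.

Lemma psi_sum (I : Type) (l : seq I) (Q : pred I) h :
  psi (\sum_(i <- l | Q i) h i) = \sum_(i <- l | Q i) psi (h i).
Proof.
apply: (big_morph psi _ psi0) => a b.
by have := psiP.1 1 a b; rewrite scale1r mul1r.
Qed.

(** Standard tableaux index a common eigenbasis for the generic products [jm_prod]. At [x = 1] the
    eigenvalues become products of differences of the [u_j], which interpolation normalizes to 0 or
    1; the value is thus a count of tableaux. *)
Lemma specht_jm_prod : is_specht_character lam chi ->
  exists (n : nat) (tab : 'I_n.+1 -> {ffun 'I_r -> box d}),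
  (forall T, std_tableau lam T <-> exists i, tab i = T) /\
  forall P : pred {ffun 'I_r -> 'I_d.+1},
    psi (cyc_incl (type_idem u v (phi (lau_x d)) P)) =
    \sum_i (P (tab_type (tab i)))%:R.
Proof.
move=> [n [rho [_ chiE [tab [Q [_ tabP Qu Qrho]]]]]]; exists n, tab; split=> // P.
(* [E] lifts the eigenvalues of [raw_jm] to the Laurent ring. The exponent of [x] is [k], undoing
   the normalization of [jucys_murphy], plus column minus row. *)
have /choice[E EP] (ik : 'I_n.+1 * 'I_r) : exists c : laurent d,
    laurent_incl c = genx d ^+ ik.2 * jm_eigenvalue (tab ik.1 ik.2) /\
    phi c = phi (lau_u (tab ik.1 ik.2).1).
  have [c [cE /(_ _ phi phi_x) c1]] := laurent_genx_exp d
    (ik.2%:Z + ((tab ik.1 ik.2).2.2%:Z - (tab ik.1 ik.2).2.1%:Z)).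
  exists (c * lau_u (tab ik.1 ik.2).1); rewrite !rmorphM c1 mul1r; split=> //.
  by rewrite cE expfzDr ?genx_neq0 // -mulrA; congr (_ * _); rewrite mulrC.
have diag_jm (k : 'I_r) : acts_diagonally Q (rho (raw_jm r _ _ k))
    (fun i => genx d ^+ k * jm_eigenvalue (tab i k)).
  have -> : raw_jm r (fun j => laurent_incl (lau_u j)) (laurent_incl (lau_x d)) k =
      genx d ^+ k *: jucys_murphy d k.
    have xk : genx d ^+ k != 0 by apply/expf_neq0/genx_neq0.
    by rewrite /jucys_murphy scalerA (divff xk) scale1r.
  by rewrite linearZ; apply: acts_diagonallyZ; apply: Qrho.
have psi_jm c : psi (cyc_incl (cyc_spec phi (jm_prod (@lau_u d) (lau_x d) c))) =
    RK_incl (\sum_l \prod_(i < r) \prod_(b | b != c i)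
      (u (tab l i).1 - u b)).
  have [a [chia ->]] := psiP.2 (jm_prod (@lau_u d) (lau_x d) c).
  suff -> : a = \sum_l \prod_(i < r) \prod_(b | b != c i) (E (l, i) - lau_u b).
    rewrite !rmorph_sum; apply: eq_bigr => l _.
    rewrite !rmorph_prod; apply: eq_bigr => i _.
    rewrite !rmorph_prod; apply: eq_bigr => b _.
    by rewrite !rmorphB (EP (l, i)).2.
  apply: laurent_incl_inj; rewrite -chia chiE /generic_incl AK_map_jm_prod.
  rewrite (acts_diagonally_tr (D := fun l => \prod_(i < r) \prod_(b | b != c i)
    (genx d ^+ i * jm_eigenvalue (tab l i) - genu b)) Qu).
    rewrite rmorph_sum; apply: eq_bigr => l _.
    rewrite rmorph_prod; apply: eq_bigr => i _.
    rewrite rmorph_prod; apply: eq_bigr => b _.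
    by rewrite rmorphB (EP (l, i)).1.
  rewrite rmorph_prod; apply: acts_diagonally_prod => i.
  rewrite rmorph_prod; apply: acts_diagonally_prod => b /=.
  have -> X k : rho (X - k%:A) = rho X - k *: 1 by rewrite linearB linearZ rmorph1.
  apply: acts_diagonallyB; first exact: diag_jm.
  rewrite (_ : (fun=> _) = fun i : 'I_n.+1 => genu b * 1); last by apply/funext => l;
    rewrite mulr1.
  exact/acts_diagonallyZ/acts_diagonally1.
have psi_pidem c : psi (cyc_incl (pidem (jm_idem u v (phi (lau_x d))) c)) =
    \sum_l (c == tab_type (tab l))%:R.
  rewrite pidem_jm_prod /cyc_incl AK_mapZ psiZ psi_jm -rmorphM mulr_sumr rmorph_sum.
  apply: eq_bigr => l _; rewrite -big_split /=.
  (* Each factor is the Lagrange polynomial of [c i] evaluated at the node of the component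
     containing the entry [i]. *)
  have -> : \prod_(i < r) (kappa v (c i) * \prod_(b | b != c i)
      (u (tab l i).1 - u b)) = \prod_(i < r) (c i == (tab l i).1)%:R.
    apply: eq_bigr => i _; rewrite -(ell_horner uv) hornerZ horner_prod.
    by congr (_ * _); apply: eq_bigr => b _; rewrite hornerXsubC.
  have [->|/eqP cl] := eqVneq c (tab_type (tab l)).
    by rewrite big1 ?rmorph1 // => i _; rewrite ffunE eqxx.
  have [i ci] : exists i, c i != (tab l i).1.
    apply/existsP; apply: contra_notT cl; rewrite negb_exists => /forallP eqc.
    by apply/ffunP => i; rewrite ffunE; apply/eqP; have := eqc i; rewrite negbK.
  by rewrite (bigD1 i) //= (negPf ci) mul0r rmorph0.
rewrite /type_idem /sidem /cyc_incl rmorph_sum psi_sum.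
under eq_bigr => c _ do rewrite psi_pidem.
rewrite exchange_big /=; apply: eq_bigr => l _.
case Pl: (P _); last first.
  by rewrite big1 // => c Pc; case: eqVneq => // cl; rewrite -cl Pc in Pl.
rewrite (bigD1 (tab_type (tab l))) //= eqxx big1 ?addr0 // => c /andP[_ /negPf->].
by [].
Qed.

End Specialization.

(** * Component sizes read off from standard tableaux *)

Section TableauType.
Variables (d r : nat) (lam : 'I_d.+1 -> seq nat).

Lemma std_tableau_type (T : {ffun 'I_r -> box d}) a :
  std_tableau lam T -> #|[set k | tab_type T k == a]| = sumn (lam a).
Proof.
move=> [Tinj Tdiag _ _].
pose boxes : seq (box d) :=
  [seq (a, (i, j)) | i <- iota 0 (size (lam a)), j <- iota 0 (nth 0%N (lam a) i)].
have -> : sumn (lam a) = size boxes.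
  rewrite size_allpairs_dep; congr sumn.
  rewrite -[LHS](mkseq_nth 0%N) /mkseq; apply: eq_map => i /=.
  by rewrite size_iota.
rewrite cardE -(size_map T); apply: perm_size; apply: uniq_perm.
- by rewrite map_inj_uniq ?enum_uniq.
- apply: allpairs_uniq_dep => [|i _|]; rewrite ?iota_uniq //.
  by move=> [i j] [i' j'] _ _ /= [-> ->].
move=> b; apply/mapP/allpairsPdep => [[k]|[i [j [ilam jlam ->]]]].
  rewrite mem_enum inE ffunE => /eqP ka ->.
  have /Tdiag : exists k', T k' = T k by exists k.
  case: (T k) ka => a' [i j] /= -> lt_j; exists i, j; rewrite !mem_iota /=.
  split=> //; rewrite add0n ltnNge; apply/negP => szi.
  by move: lt_j; rewrite /in_diagram /= nth_default.
have /Tdiag[k Tk] : in_diagram lam (a, (i, j)) by move: jlam; rewrite mem_iota.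
by exists k; rewrite // mem_enum inE ffunE Tk.
Qed.

Definition has_type (c : {ffun 'I_r -> 'I_d.+1}) : bool :=
  [forall a, #|[set k | c k == a]| == sumn (lam a)].

Lemma has_type_perm (p : {perm 'I_r}) (c : {ffun 'I_r -> 'I_d.+1}) :
  has_type [ffun i => c (p i)] = has_type c.
Proof.
apply: eq_forallb => a; congr (_ == _).
rewrite -(card_imset _ (@perm_inj _ p)); apply: eq_card => k; rewrite [RHS]inE.
apply/imsetP/idP => [[i]|ck]; first by rewrite inE ffunE => ? ->.
by exists (p^-1%g k); rewrite ?inE ?ffunE permKV.
Qed.

End TableauType.

(** On the central idempotent of type [lam], [psi_lam] takes the number of standard tableaux of
    [lam], which is nonzero; hence [psi_mu] takes its full value [psi_mu 1] there. As this is
    nonzero too, some standard tableau of [mu] has type [lam]. *)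
Lemma same_block_sizes (K : fieldType) (zeta : K) (d r : nat)
    (phi : {rmorphism laurent d -> RK zeta})
    (v : 'I_d.+1 -> 'I_d.+1 -> RK zeta) lam mu
    (chi_lam chi_mu : generic_AK_Qux d r -> Qux d)
    (psi_lam psi_mu : cyc_AK_Ky r phi -> Ky K) :
  (forall n, n.+1%:R != 0 :> K) -> (0 < r)%N -> phi (lau_x d) = 1 ->
  (forall a b, a != b -> (phi (lau_u a) - phi (lau_u b)) * v a b = 1) ->
  is_specht_character lam chi_lam -> is_specht_character mu chi_mu ->
  specialized_character chi_lam psi_lam -> specialized_character chi_mu psi_mu ->
  same_rouquier_block psi_lam psi_mu ->
  forall a, sumn (lam a) = sumn (mu a).
Proof.
move=> K0 r0 phix uv slam smu plam pmu same a.
have RK_inj : injective (@RK_incl K zeta) by exact: val_inj.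
have id_inj : injective (idfun : {rmorphism Ky K -> Ky K}) by [].
have uvK a' b : a' != b -> (RK_incl (phi (lau_u a')) - RK_incl (phi (lau_u b))) *
    RK_incl (v a' b) = 1 by move=> /uv ab; rewrite -rmorphB -rmorphM ab rmorph1.
have phixK : RK_incl (phi (lau_x d)) = 1 by rewrite phix rmorph1.
(* The spanning list is taken over K(y) itself, with the identity as the embedding into a field; the
   idempotent below lives over [RK]. *)
have span := AK_spanningP id_inj r0 phixK uvK.
have cidem := type_idem_central_idempotent RK_inj r0 phix uv (@has_type_perm d r lam).
have [n [tab [tabP psiE]]] := specht_jm_prod phix uv plam slam.
have [n' [tab' [tabP' psiE']]] := specht_jm_prod phix uv pmu smu.
have tabT i : has_type lam (tab_type (tab i)).
  by apply/forallP => b; rewrite (std_tableau_type b (lam := lam)) //; apply/tabP;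
    exists i.
have := same_block_central_idempotent K0 span same cidem.
rewrite psiE (eq_bigr (fun=> 1)) => [|i _]; last by rewrite tabT.
rewrite sumr_const card_ord => /(_ (Ky_char0 K0 n)); rewrite psiE'.
have -> : psi_mu 1 = \sum_(i < n'.+1) 1.
  have := psiE' predT; rewrite (_ : type_idem _ _ _ _ = 1) /cyc_incl ?rmorph1 //.
  by apply: sum_pidem => i; apply: (lidem_sum RK_inj uv).
have [i ti _|nt] := pickP (fun i => has_type lam (tab_type (tab' i))).
  have /forallP/(_ a)/eqP <- := ti; rewrite (std_tableau_type a (lam := mu)) //.
  by apply/tabP'; exists i.
rewrite big1 => [|i _]; last by rewrite nt.
by move/esym/eqP; rewrite sumr_const card_ord (negPf (Ky_char0 K0 n')).
Qed.

(** * Units of R_K(y) *)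

Section PrimeIdeals.
Variable A : comNzRingType.

(** Zorn's lemma on the proper ideals containing [z] gives a maximal one, which is prime. *)
Lemma nonunit_in_prime_ideal (z : A) : (forall y, z * y <> 1) ->
  exists I : {pred A}, [/\ idealr_closed I, prime_idealr_closed I & z \in I].
Proof.
move=> zN1.
pose T := {I : A -> bool | idealr_closed (I : {pred A}) /\ z \in (I : {pred A})}.
pose le (I J : T) := `[< forall a, sval I a -> sval J a >].
have [] := @Zorn T le.
- by move=> I; apply/asboolP.
- by move=> J I L /asboolP IJ /asboolP JL; apply/asboolP => a /IJ/JL.
- move=> [I HI] [J HJ] /asboolP /= IJ /asboolP /= JI.
  have eIJ : I = J by apply/funext => a; apply/idP/idP => [/IJ|/JI].
  by subst J; congr exist; apply: Prop_irrelevance.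
- move=> C Ctot; have [[I0 CI0]|C0] := pselect (exists I, C I); last first.
    (* The empty chain is bounded by the principal ideal of [z], proper because [z] is not a
       unit. *)
    pose Z : A -> bool := fun a => `[< exists y, a = z * y >].
    have ZP : idealr_closed (Z : {pred A}) /\ z \in (Z : {pred A}).
      split; last by apply/asboolP; exists 1; rewrite mulr1.
      split.
      - by apply/asboolP; exists 0; rewrite mulr0.
      - by apply/asboolP => -[y /esym]; exact: zN1.
      - move=> a b c /asboolP[y ->] /asboolP[y' ->]; apply/asboolP.
        by exists (a * y + y'); ring.
    by exists (exist _ Z ZP) => I CI; case: C0; exists I.
  pose U : A -> bool := fun a => `[< exists2 I, C I & sval I a >].
  have UP : idealr_closed (U : {pred A}) /\ z \in (U : {pred A}).
    split; last by apply/asboolP; exists I0 => //; have [] := svalP I0.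
    split.
    - by apply/asboolP; exists I0 => //; have [[]] := svalP I0.
    - apply/asboolP => -[I CI I1]; have [[_ /negP]] := svalP I; exact.
    - move=> a b c /asboolP[I CI Ib] /asboolP[J CJ Jc]; apply/asboolP.
      have [/asboolP IJ|/asboolP JI] := Ctot _ _ CI CJ.
        by exists J => //; have [[_ _ H] _] := svalP J; apply: H => //; apply: IJ.
      by exists I => //; have [[_ _ H] _] := svalP I; apply: H => //; apply: JI.
  exists (exist _ U UP) => I CI; apply/asboolP => a Ia /=.
  by apply/asboolP; exists I.
move=> M Mmax; have [[M0 M1 MD] Mz] := svalP M; set m := sval M in M0 M1 MD Mz.
have MM a b : b \in m -> a * b \in m by move=> mb; rewrite -[_ * _]addr0 MD.
exists m; split=> //.
(* By maximality an element outside [m] generates the unit ideal together with [m], and two such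
   elements cannot have their product in [m]. *)
suff max_inv u : u \notin m -> exists a b, b \in m /\ 1 = a * u + b.
  move=> u v muv; case: (boolP (u \in m)) => //= /max_inv[a [b [mb e1]]].
  case: (boolP (v \in m)) => //= /max_inv[a' [b' [mb' e1']]].
  case/negP: M1; rewrite -[1]mulr1 {1}e1 e1'.
  have -> : (a * u + b) * (a' * v + b') = (a * a') * (u * v) + ((a * u + b) * b' + (a' * v) * b).
    by ring.
  by rewrite MD // MD // MM.
move=> mu; pose J : A -> bool := fun x => `[< exists a b, b \in m /\ x = a * u + b >].
case: (boolP (J 1)) => [/asboolP//|J1].
have mJ a : a \in m -> J a.
  by move=> ma; apply/asboolP; exists 0, a; rewrite mul0r add0r.
have JP : idealr_closed (J : {pred A}) /\ z \in (J : {pred A}).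
  split; last exact: mJ.
  split=> //; first exact: mJ.
  move=> a x y /asboolP[b [c [mc ->]]] /asboolP[b' [c' [mc' ->]]]; apply/asboolP.
  by exists (a * b + b'), (a * c + c'); split; [exact: MD | ring].
have eMJ : exist _ J JP = M.
  by apply: Mmax; apply/asboolP.
case/negP: mu; rewrite /m -eMJ /=; apply/asboolP; exists 1, 0.
by rewrite mul1r addr0.
Qed.

End PrimeIdeals.

Section CyclotomicUnits.
Variables (K F : fieldType) (iota : {rmorphism K -> F}) (zeta : K) (d w : nat) (y : F).
Variable rk : subringClosed F.
Hypotheses (w_gt0 : (0 < w)%N) (zeta_prim : d.+1.-primitive_root zeta).
Hypotheses (y_neq0 : y != 0) (rk_y : y \in rk) (rk_yV : y^-1 \in rk).
Hypothesis rk_ZK : forall z : ZK zeta, iota (srval z) \in rk.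
Hypothesis yN_inv : forall N, (0 < N)%N -> y ^+ N - 1 != 0 /\ (y ^+ N - 1)^-1 \in rk.
Local Notation q := (y ^+ w).

Lemma rk_zeta : iota zeta \in rk.
Proof. exact: (rk_ZK (ZK_zeta zeta)). Qed.

Lemma q_neq0 : q != 0.
Proof. by rewrite expf_neq0. Qed.

Lemma rk_q (z : int) : q ^ z \in rk.
Proof.
case: z => n; first by rewrite -exprnP !rpredX.
by rewrite -[_ ^ _]/((q ^+ n.+1)^-1) -!exprVn !rpredX.
Qed.

Definition cyc_param (m : 'I_d.+1 -> int) (j : 'I_d.+1) : F :=
  iota (zeta ^+ j) * q ^ m j.

Lemma zeta_neq0 : zeta != 0.
Proof.
apply/eqP => z0; have := prim_expr_order zeta_prim.
by rewrite z0 expr0n => /eqP; rewrite eq_sym oner_eq0.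
Qed.

Lemma zetaV : zeta^-1 = zeta ^+ d.
Proof.
apply: (mulfI zeta_neq0); rewrite divff ?zeta_neq0 // -exprS.
by rewrite (prim_expr_order zeta_prim).
Qed.

Lemma cyc_param_neq0 m j : cyc_param m j != 0.
Proof.
apply: mulf_neq0; last exact/expfz_neq0/q_neq0.
by rewrite fmorph_eq0 expf_neq0 // zeta_neq0.
Qed.

Lemma rk_cyc_paramV m j : (cyc_param m j)^-1 \in rk.
Proof.
rewrite invfM invr_expz rpredM ?rk_q // -fmorphV -exprVn zetaV !rmorphXn /=.
by rewrite !rpredX ?rk_zeta.
Qed.

(** With [z = iota c * q ^+ k], the element [1 - z] divides [1 - z ^+ d.+1]; since [c ^+ d.+1 = 1],
    the latter is [1 - y ^+ N], a unit of [rk] by [yN_inv]. *)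
Lemma rk_inv_1sub (c : K) (k : nat) : c ^+ d.+1 = 1 -> iota c \in rk -> (0 < k)%N ->
  (1 - iota c * q ^+ k)^-1 \in rk /\ 1 - iota c * q ^+ k != 0.
Proof.
move=> c1 ck k_gt0; set z := iota c * _.
have zk : z \in rk by rewrite rpredM //; exact: (rk_q k).
pose N := (w * k * d.+1)%N; have N_gt0 : (0 < N)%N by rewrite !muln_gt0 w_gt0 k_gt0.
have zN : z ^+ d.+1 = y ^+ N.
  by rewrite exprMn -!exprM -rmorphXn c1 rmorph1 mul1r.
have [yN yNV] := yN_inv N_gt0.
have e : y ^+ N - 1 = - ((1 - z) * \sum_(i < d.+1) z ^+ i).
  by rewrite -zN subrX1 -mulNr opprB.
have z1 : 1 - z != 0.
  by apply: contraNneq yN => z1; rewrite e z1 mul0r oppr0.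
split=> //.
have -> : (1 - z)^-1 = - (\sum_(i < d.+1) z ^+ i) * (y ^+ N - 1)^-1.
  by apply: (mulfI z1); rewrite divff // mulrA mulrN -e divff.
by rewrite rpredM ?rpredN ?rpred_sum // => i _; apply: rpredX.
Qed.

Lemma rk_cyc_param_subV_lt m (s t : 'I_d.+1) : m s < m t ->
  (cyc_param m s - cyc_param m t)^-1 \in rk /\ cyc_param m s - cyc_param m t != 0.
Proof.
move=> mst; pose k := `|m t - m s|%N; pose c := zeta ^+ t / zeta ^+ s.
have ke : m t = m s + k%:Z by rewrite /k; lia.
have k_gt0 : (0 < k)%N by rewrite absz_gt0 subr_eq0 gt_eqF.
have cu : cyc_param m t = cyc_param m s * (iota c * q ^+ k).
  rewrite /cyc_param ke expfzDr ?q_neq0 // /c rmorphM fmorphV /=.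
  have := cyc_param_neq0 m s; rewrite /cyc_param mulf_eq0 negb_or => /andP[zs _].
  by rewrite -exprnP; field.
have c1 : c ^+ d.+1 = 1.
  by rewrite /c expr_div_n -!exprM ![(_ * d.+1)%N]mulnC !exprM
     (prim_expr_order zeta_prim) !expr1n divr1.
have ck : iota c \in rk.
  by rewrite /c -exprVn zetaV !(rmorphM, rmorphXn) /= rpredM ?rpredX ?rk_zeta.
have [iz nz] := rk_inv_1sub c1 ck k_gt0.
rewrite cu -{1 3}[cyc_param m s]mulr1 -mulrBr invfM.
by rewrite rpredM ?rk_cyc_paramV // mulf_neq0 ?cyc_param_neq0.
Qed.

(** For [m s] and [m t] distinct this is the previous lemma, up to sign. If they agree, the
    difference is a power of [q] times the image of [zeta ^+ s - zeta ^+ t], a unit of [ZK]: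
    otherwise a prime ideal would contain it, and [hyperplane 0 s t] would be a second essential
    hyperplane through the parameters. *)
Lemma rk_cyc_param_subV r m (s t : 'I_d.+1) : (0 < r)%N ->
  associated_with zeta r m 0 (@hyperplaneN d) -> s != t ->
  (cyc_param m s - cyc_param m t)^-1 \in rk /\ cyc_param m s - cyc_param m t != 0.
Proof.
move=> r_gt0 [_ _ Hass]; wlog st : s t / (s < t)%N => [th|_].
  rewrite -val_eqE /= neq_ltn => /orP[st|ts]; first by apply: th => //;
    rewrite -val_eqE neq_ltn st.
  rewrite -opprB invrN rpredN oppr_eq0.
  by apply: th => //; rewrite -val_eqE /= neq_ltn ts.
have [mst|mst|mst] := ltgtP (m s) (m t).
- exact: rk_cyc_param_subV_lt.
- by rewrite -opprB invrN rpredN oppr_eq0; apply: rk_cyc_param_subV_lt.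
pose z := ZK_zeta zeta ^+ s - ZK_zeta zeta ^+ t.
pose vK : {rmorphism ZK zeta -> K} := (val : ZK zeta -> K).
have zE : vK z = zeta ^+ s - zeta ^+ t by rewrite rmorphB !rmorphXn.
have [[z' zz']|zN] := pselect (exists z', z * z' = 1); last first.
  have zprime : in_some_prime_ideal z.
    by apply: nonunit_in_prime_ideal => z' zz'; apply: zN; exists z'.
  have Hess : essential_hyperplane zeta r (hyperplane 0 s t).
    by right; exists 0, s, t; split=> //; rewrite oppr_lt0 ltz_nat r_gt0.
  have eqH : hyperplane 0 s t = @hyperplaneN d.
    by apply: Hass => //=; rewrite /hyperplane /= mulr0z mul0r add0r mst subrr.
  (* The point with all [M_j = 0] and [N = 1] separates the two hyperplanes. *)
  have : @hyperplaneN d (fun=> 0, 1) by rewrite -eqH /hyperplane /= mulr0z mul0r !(add0r, oppr0).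
  by rewrite /hyperplaneN /= => /eqP; rewrite oner_eq0.
have zV : (zeta ^+ s - zeta ^+ t) * srval z' = 1.
  by rewrite -zE -[srval z']/(vK z') -rmorphM zz' rmorph1.
have zn : zeta ^+ s - zeta ^+ t != 0.
  by apply/eqP => z0; move/eqP: zV; rewrite z0 mul0r eq_sym oner_eq0.
have yE : (zeta ^+ s - zeta ^+ t)^-1 = srval z' by apply: (mulfI zn); rewrite divff.
rewrite /cyc_param mst -mulrBl -rmorphB invfM invr_expz -fmorphV yE /=.
split; first by rewrite rpredM ?rk_q ?rk_ZK.
by apply: mulf_neq0; [rewrite fmorph_eq0 | exact/expfz_neq0/q_neq0].
Qed.

End CyclotomicUnits.

(** * Laurent polynomials in q *)

Section LaurentInQ.
Variables (K F : fieldType) (iota : {rmorphism K -> F}) (q : F).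
Hypothesis q_neq0 : q != 0.

Definition laurent_eval (a : int) (P : {poly K}) : F := q ^ a * (map_poly iota P).[q].
(** Encodes nonzero Laurent polynomials in [q]; the nonzero constant coefficient makes the exponent
    [a] the valuation. *)
Definition laurent_in_q (f : F) : Prop :=
  exists (a : int) (P : {poly K}), P`_0 != 0 /\ f = laurent_eval a P.

Lemma laurent_evalM a b P Q :
  laurent_eval a P * laurent_eval b Q = laurent_eval (a + b) (P * Q).
Proof. by rewrite /laurent_eval rmorphM hornerM expfzDr // mulrACA. Qed.

Lemma laurent_evalC a c : laurent_eval a c%:P = iota c * q ^ a.
Proof. by rewrite /laurent_eval map_polyC hornerC mulrC. Qed.

Lemma laurent_in_qM f g : laurent_in_q f -> laurent_in_q g -> laurent_in_q (f * g).
Proof.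
move=> [a [P [P0 ->]]] [b [Q [Q0 ->]]]; exists (a + b), (P * Q).
by rewrite coef0M mulf_neq0 // laurent_evalM.
Qed.

Lemma laurent_in_q_monomial c a : c != 0 -> laurent_in_q (iota c * q ^ a).
Proof. by move=> c0; exists a, c%:P; rewrite coefC eqxx laurent_evalC. Qed.

Lemma laurent_in_q1 : laurent_in_q 1.
Proof.
by rewrite -[1]mulr1 -{1}(rmorph1 iota) -(expr0z q);
  apply/laurent_in_q_monomial/oner_neq0.
Qed.

Lemma laurent_in_q_prod (I : Type) (l : seq I) (P : pred I) G :
  (forall i, P i -> laurent_in_q (G i)) -> laurent_in_q (\prod_(i <- l | P i) G i).
Proof. by apply: big_ind; [exact: laurent_in_q1 | exact: laurent_in_qM]. Qed.

Lemma laurent_in_qX f n : laurent_in_q f -> laurent_in_q (f ^+ n).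
Proof.
move=> fq; elim: n => [|n IH]; first exact: laurent_in_q1.
by rewrite exprS; apply: laurent_in_qM.
Qed.

Variables (zeta : K) (d : nat) (m : 'I_d.+1 -> int).
Hypothesis zeta_prim : d.+1.-primitive_root zeta.
Let u (j : 'I_d.+1) : F := iota (zeta ^+ j) * q ^ m j.

Let zetaX_neq0 k : zeta ^+ k != 0.
Proof. by rewrite expf_neq0 // (zeta_neq0 zeta_prim). Qed.

Lemma laurent_in_q_param j : laurent_in_q (u j).
Proof. exact: laurent_in_q_monomial. Qed.

Lemma laurent_in_q_paramV j : laurent_in_q (u j)^-1.
Proof.
by rewrite invfM invr_expz -fmorphV; apply: laurent_in_q_monomial; rewrite invr_eq0.
Qed.

Lemma laurent_in_qN f : laurent_in_q f -> laurent_in_q (- f).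
Proof.
move=> [a [P [P0 ->]]]; exists a, (- P).
by rewrite coefN oppr_eq0 P0 /laurent_eval rmorphN hornerN mulrN.
Qed.

Lemma laurent_in_q_param_sub_lt s t : m s < m t -> laurent_in_q (u s - u t).
Proof.
move=> mst; pose k := `|m t - m s|%N.
have ke : m t = m s + k%:Z by rewrite /k; lia.
have k_gt0 : (0 < k)%N by rewrite /k; lia.
exists (m s), ((zeta ^+ s)%:P - (zeta ^+ t)%:P * 'X^k); split.
  rewrite coefB coefC eqxx coefCM coefXn (ltn_eqF k_gt0) mulr0 subr0.
  exact: zetaX_neq0.
rewrite /laurent_eval rmorphB rmorphM /= map_polyXn !map_polyC !hornerE /=.
by rewrite /u ke expfzDr // -exprnP !rmorphXn /=; ring.
Qed.

Lemma laurent_in_q_param_sub s t : u s - u t != 0 -> laurent_in_q (u s - u t).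
Proof.
have [mst _|mst _|mst] := ltgtP (m s) (m t).
- exact: laurent_in_q_param_sub_lt.
- by rewrite -opprB; apply/laurent_in_qN/laurent_in_q_param_sub_lt.
rewrite /u mst -mulrBl -rmorphB mulf_eq0 negb_or => /andP[st _].
by apply: laurent_in_q_monomial; rewrite -(fmorph_eq0 iota).
Qed.

(** Nonzero scalars change neither the exponent nor the size of the polynomial, so both elements
    have the same valuation and degree in [q]. *)
Lemma val_deg_const_mul f g W (c c' : K) : c != 0 -> c' != 0 -> laurent_in_q W ->
  f = iota c * W -> g = iota c' * W ->
  exists (a : int) (P P' : {poly K}), [/\ P`_0 != 0, P'`_0 != 0, size P = size P',
    f = laurent_eval a P & g = laurent_eval a P'].
Proof.
move=> c0 c'0 [a [P [P0 ->]]] -> ->; exists a, (c *: P), (c' *: P).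
rewrite !coefZ !mulf_neq0 // !size_scale //; split=> //.
  by rewrite /laurent_eval map_polyZ hornerZ mulrCA.
by rewrite /laurent_eval map_polyZ hornerZ mulrCA.
Qed.

End LaurentInQ.

Section EqUpToConstant.
Variables (K F : fieldType) (iota : {rmorphism K -> F}).

(** This relation preserves valuation and degree in [q], and it absorbs the signs and the integers
    that appear at [x = 1]. *)
Definition eq_const (f g : F) : Prop := exists2 c : K, c != 0 & f = iota c * g.

Lemma eq_const_refl f : eq_const f f.
Proof. by exists 1; rewrite ?oner_neq0 // rmorph1 mul1r. Qed.

Lemma eq_constM f g f' g' : eq_const f g -> eq_const f' g' -> eq_const (f * f') (g * g').
Proof.
move=> [c c0 ->] [c' c'0 ->]; exists (c * c'); first by rewrite mulf_neq0.
by rewrite rmorphM /=; ring.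
Qed.

Lemma eq_const_trans g f h : eq_const f g -> eq_const g h -> eq_const f h.
Proof.
move=> [c c0 ->] [c' c'0 ->]; exists (c * c'); first by rewrite mulf_neq0.
by rewrite rmorphM mulrA.
Qed.

Lemma eq_const_sym f g : eq_const f g -> eq_const g f.
Proof.
move=> [c c0 ->]; exists c^-1; first by rewrite invr_eq0.
by rewrite mulrA -rmorphM mulVf // rmorph1 mul1r.
Qed.

Lemma eq_const_prod (I : Type) (l : seq I) (P : pred I) (G H : I -> F) :
  (forall i, P i -> eq_const (G i) (H i)) ->
  eq_const (\prod_(i <- l | P i) G i) (\prod_(i <- l | P i) H i).
Proof.
by move=> GH; apply: (big_ind2 eq_const) => //; [exact: eq_const_refl | exact: eq_constM].
Qed.

Lemma eq_constX f g n : eq_const f g -> eq_const (f ^+ n) (g ^+ n).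
Proof.
move=> [c c0 ->]; exists (c ^+ n); first by rewrite expf_neq0.
by rewrite exprMn rmorphXn.
Qed.

Lemma eq_constN f : eq_const (- f) f.
Proof.
by exists (-1); rewrite ?oppr_eq0 ?oner_eq0 // rmorphN1 mulN1r.
Qed.

Lemma eq_const_cancel f g h : h != 0 -> eq_const (f * h) (g * h) -> eq_const f g.
Proof.
by move=> h0 [c c0]; rewrite mulrA => /(mulIf h0) ->; exists c.
Qed.

End EqUpToConstant.

(** * Schur elements at x = 1 *)

Definition tri (L : nat) : nat := (\sum_(i < L) (L - i.+1))%N.

Lemma triE L : (L + tri L + tri L = L * L)%N.
Proof.
elim: L => [|L IH]; first by rewrite /tri big_ord0.
have -> : tri L.+1 = (L + tri L)%N.
  by rewrite /tri big_ord_recl subn1; congr addn; apply: eq_bigr => i _;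
    rewrite /bump /=; lia.
by nia.
Qed.

Lemma count_gt L (i : nat) : (\sum_(j < L | (i < j)%N) 1 = L - i.+1)%N.
Proof.
rewrite -(big_geq_mkord i.+1 L xpredT (fun=> 1%N)) sum_nat_const_nat muln1.
by [].
Qed.

Lemma sum_nth_sumn (l : seq nat) L : (size l <= L)%N ->
  (\sum_(i < L) nth 0 l i = sumn l)%N.
Proof.
elim: l L => [|a l IH] L; first by move=> _; rewrite big1 // => i _; rewrite nth_nil.
by case: L => // L lL; rewrite big_ord_recl /= IH.
Qed.

Section Beta.
Variables (d : nat) (lam : 'I_d.+1 -> seq nat) (L : nat).

Lemma sum_beta a : (size (lam a) <= L)%N ->
  (\sum_(i < L) beta lam L a i = sumn (lam a) + tri L)%N.
Proof. by move=> lL; rewrite big_split /= sum_nth_sumn. Qed.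

Lemma beta_lt a i j : sorted geq (lam a) -> (i < j)%N -> (j < L)%N ->
  (beta lam L a j < beta lam L a i)%N.
Proof.
move=> srt ij jL; rewrite /beta.
suff : (nth 0 (lam a) j <= nth 0 (lam a) i)%N by lia.
have [js|js] := ltnP j (size (lam a)); last by rewrite nth_default.
have geq_trans : transitive geq by move=> x y z /= xy yz; apply: leq_trans yz xy.
by apply: (sorted_ltn_nth geq_trans 0%N srt) => //; rewrite inE // (ltn_trans ij).
Qed.
End Beta.

Section SchurFactors.
Variables (S : comNzRingType) (d : nat) (u : 'I_d.+1 -> S) (x : S).
Variables (b : 'I_d.+1 -> nat -> nat) (L : nat).

Definition qint (k : nat) : S := \sum_(i < k) x ^+ i.

(** For equal components [x ^+ k - 1] is [x - 1] times the quantum integer [qint k], and the factor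
    [x - 1] is dropped. With [red_nu] and [red_delta] built this way, the Schur element can be
    specialized at [x = 1]. *)
Definition nu_factor (s t : 'I_d.+1) (k : nat) : S :=
  if s == t then u s * qint k else x ^+ k * u s - u t.

Definition red_nu : S :=
  (\prod_(s < d.+1) \prod_(t < d.+1 | (s < t)%N) (u s - u t) ^+ L) *
  (\prod_(s < d.+1) \prod_(t < d.+1) \prod_(i < L)
     \prod_(1 <= k < (b s i).+1) nu_factor s t k).

Definition red_delta : S :=
  (\prod_(s < d.+1) \prod_(t < d.+1 | (s < t)%N) \prod_(i < L) \prod_(j < L)
     (x ^+ b s i * u s - x ^+ b t j * u t)) *
  (\prod_(s < d.+1) \prod_(i < L) \prod_(j < L | (i < j)%N)
     (x ^+ b s j * u s * qint (b s i - b s j))).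

Lemma nu_factorE s t k :
  x ^+ k * u s - u t = (if s == t then x - 1 else 1) * nu_factor s t k.
Proof.
rewrite /nu_factor; case: eqP => [<-|_]; last by rewrite mul1r.
rewrite mulrCA /qint -subrX1; ring.
Qed.

Lemma delta_factorE s i j : (b s j <= b s i)%N ->
  x ^+ b s i * u s - x ^+ b s j * u s =
  (x - 1) * (x ^+ b s j * u s * qint (b s i - b s j)).
Proof. by move=> le_b; rewrite mulrCA /qint -subrX1 -{1}(subnKC le_b) exprD; ring. Qed.

(** Only the pairs with [s = t] contribute factors [x - 1]: one for each [k], hence [b s i] of them
    for each [i]. *)
Lemma nu_split :
  (\prod_(s < d.+1) \prod_(t < d.+1 | (s < t)%N) (u s - u t) ^+ L) *
  (\prod_(s < d.+1) \prod_(t < d.+1) \prod_(i < L)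
     \prod_(1 <= k < (b s i).+1) (x ^+ k * u s - u t)) =
  (x - 1) ^+ (\sum_(s < d.+1) \sum_(i < L) b s i)%N * red_nu.
Proof.
rewrite mulrCA; congr (_ * _); rewrite -prodrXr -big_split /=.
apply: eq_bigr => s _; rewrite -prodrXr (bigD1 s) //= [in RHS](bigD1 s) //= mulrA.
congr (_ * _); last first.
  apply: eq_bigr => t ts; apply: eq_bigr => i _; apply: eq_bigr => k _.
  by rewrite nu_factorE eq_sym (negPf ts) mul1r.
rewrite -big_split; apply: eq_bigr => i _ /=.
have -> : (x - 1) ^+ b s i = \prod_(1 <= k < (b s i).+1) (x - 1).
  by rewrite prodr_const_nat subn1.
rewrite -big_split; apply: eq_bigr => k _ /=.
by rewrite nu_factorE eqxx.
Qed.

(** Each pair [i < j] within one component contributes a single [x - 1], and each of the [d.+1]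
    components has [tri L] such pairs. *)
Lemma delta_split : (forall s i j, (i < j)%N -> (j < L)%N -> (b s j <= b s i)%N) ->
  (\prod_(s < d.+1) \prod_(t < d.+1 | (s < t)%N) \prod_(i < L) \prod_(j < L)
     (x ^+ b s i * u s - x ^+ b t j * u t)) *
  (\prod_(s < d.+1) \prod_(i < L) \prod_(j < L | (i < j)%N)
     (x ^+ b s i * u s - x ^+ b s j * u s)) =
  (x - 1) ^+ (d.+1 * tri L)%N * red_delta.
Proof.
move=> b_le; rewrite mulrCA; congr (_ * _).
have -> : (x - 1) ^+ (d.+1 * tri L)%N =
    \prod_(s < d.+1) \prod_(i < L) \prod_(j < L | (i < j)%N) (x - 1).
  rewrite (eq_bigr (fun=> (x - 1) ^+ tri L)) => [|s _].
    by rewrite prodr_const card_ord -exprM mulnC.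
  rewrite -prodrXr; apply: eq_bigr => i _.
  by rewrite -count_gt -prodrXr; apply: eq_bigr => j _; rewrite expr1.
rewrite -big_split; apply: eq_bigr => s _; rewrite -big_split; apply: eq_bigr => i _.
rewrite -big_split; apply: eq_bigr => j ij /=.
by rewrite delta_factorE // b_le.
Qed.

End SchurFactors.

Section Functoriality.
Variables (S T : comNzRingType) (f : {rmorphism S -> T}) (d : nat).
Variables (u : 'I_d.+1 -> S) (x : S) (b : 'I_d.+1 -> nat -> nat) (L : nat).

Lemma rmorph_qint k : f (qint x k) = qint (f x) k.
Proof. by rewrite rmorph_sum; apply: eq_bigr => i _; rewrite rmorphXn. Qed.

Lemma rmorph_red_nu : f (red_nu u x b L) = red_nu (fun j => f (u j)) (f x) b L.
Proof.
rewrite rmorphM !rmorph_prod; congr (_ * _); apply: eq_bigr => s _; rewrite rmorph_prod.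
  by apply: eq_bigr => t _; rewrite rmorphXn rmorphB.
apply: eq_bigr => t _; rewrite rmorph_prod; apply: eq_bigr => i _.
rewrite rmorph_prod; apply: eq_bigr => k _; rewrite /nu_factor.
by case: ifP => _; rewrite ?rmorphB !rmorphM ?rmorph_qint ?rmorphXn.
Qed.

Lemma rmorph_red_delta : f (red_delta u x b L) = red_delta (fun j => f (u j)) (f x) b L.
Proof.
rewrite rmorphM !rmorph_prod; congr (_ * _); apply: eq_bigr => s _; rewrite rmorph_prod.
  apply: eq_bigr => t _; rewrite rmorph_prod; apply: eq_bigr => i _.
  rewrite rmorph_prod; apply: eq_bigr => j _.
  by rewrite rmorphB !rmorphM !rmorphXn.
apply: eq_bigr => i _; rewrite rmorph_prod; apply: eq_bigr => j _.
by rewrite !rmorphM rmorph_qint rmorphXn.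
Qed.
End Functoriality.

Section SpecializedSchur.
Variables (K F : fieldType) (iota : {rmorphism K -> F}).
Hypothesis K_char0 : forall n, n.+1%:R != 0 :> K.
Variables (d : nat) (u : 'I_d.+1 -> F).
Hypothesis u_neq0 : forall s, u s != 0.
Hypothesis u_sub : forall s t, s != t -> u s - u t != 0.
Variables (b : 'I_d.+1 -> nat -> nat) (L : nat).
Hypothesis b_lt : forall s i j, (i < j)%N -> (j < L)%N -> (b s j < b s i)%N.
Local Notation eqc := (eq_const iota).

(** What [nu_factor] becomes at [x = 1], up to the integer [k]. *)
Definition wfactor (s t : 'I_d.+1) : F := if s == t then u s else u s - u t.
Let Delta : F := \prod_(s < d.+1) \prod_(t < d.+1 | (s < t)%N) (u s - u t).
Let U : F := \prod_s u s.

Lemma qint1 k : qint (1 : F) k = k%:R.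
Proof.
rewrite /qint (eq_bigr (fun=> 1)) => [|i _]; last by rewrite expr1n.
by rewrite sumr_const card_ord.
Qed.

Lemma eq_const_natl k f : (0 < k)%N -> eqc (f * k%:R) f.
Proof.
case: k => // k _; exists k.+1%:R => //; by rewrite rmorph_nat mulrC.
Qed.

Lemma Delta_neq0 : Delta != 0.
Proof.
apply/prodf_neq0 => s _; apply/prodf_neq0 => t st.
by apply: u_sub; rewrite -val_eqE /= neq_ltn st.
Qed.

Lemma U_neq0 : U != 0.
Proof. by apply/prodf_neq0. Qed.

(** At [x = 1] the numbers [b] survive only in the integers [b s i - b s j], which are positive and
    so are nonzero constants in characteristic 0. *)
Lemma red_delta1 : eqc (red_delta u 1 b L) (Delta ^+ (L * L) * U ^+ tri L).
Proof.
apply: eq_constM.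
  rewrite /Delta -prodrXl; apply: eq_const_prod => s _.
  rewrite -prodrXl; apply: eq_const_prod => t _.
  rewrite (eq_bigr (fun=> (u s - u t) ^+ L)) => [|i _].
    by rewrite prodr_const card_ord -exprM; apply: eq_const_refl.
  rewrite (eq_bigr (fun=> u s - u t)) => [|j _]; last by rewrite !expr1n !mul1r.
  by rewrite prodr_const card_ord.
rewrite /U -prodrXl; apply: eq_const_prod => s _.
rewrite /tri -prodrXr; apply: eq_const_prod => i _.
rewrite -count_gt -prodrXr; apply: eq_const_prod => j ij.
rewrite expr1n mul1r expr1 qint1; apply: eq_const_natl.
by rewrite subn_gt0 b_lt.
Qed.

Lemma red_delta1_neq0 : red_delta u 1 b L != 0.
Proof.
have [c c0 ->] := red_delta1.
by rewrite !mulf_neq0 ?fmorph_eq0 ?expf_neq0 ?Delta_neq0 ?U_neq0.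
Qed.

Lemma red_nu1 : eqc (red_nu u 1 b L)
  (Delta ^+ L * \prod_(s < d.+1) \prod_(t < d.+1) wfactor s t ^+ (\sum_(i < L) b s i)).
Proof.
apply: eq_constM.
  rewrite /Delta -prodrXl; apply: eq_const_prod => s _.
  by rewrite -prodrXl; apply: eq_const_refl.
apply: eq_const_prod => s _; apply: eq_const_prod => t _.
rewrite -prodrXr; apply: eq_const_prod => i _.
have -> : wfactor s t ^+ b s i = \prod_(1 <= k < (b s i).+1) wfactor s t.
  by rewrite prodr_const_nat subn1.
rewrite !big_nat; apply: eq_const_prod => k /andP[k_gt0 _].
rewrite /nu_factor /wfactor; case: ifP => _; last first.
  by rewrite expr1n mul1r; apply: eq_const_refl.
by rewrite qint1; apply: eq_const_natl.
Qed.

(** The diagonal pairs give [U], and each unordered pair of distinct components occurs twice, with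
    opposite signs. *)
Lemma prod_wfactor : eqc (\prod_(s < d.+1) \prod_(t < d.+1) wfactor s t) (U * Delta ^+ 2).
Proof.
have -> : \prod_(s < d.+1) \prod_(t < d.+1) wfactor s t =
    U * (Delta * \prod_(s < d.+1) \prod_(t < d.+1 | (t < s)%N) (u s - u t)).
  rewrite /U /Delta -!big_split; apply: eq_bigr => s _ /=.
  rewrite (bigD1 s) //= /wfactor eqxx; congr (_ * _).
  rewrite (bigID (fun t : 'I_d.+1 => (s < t)%N)) /=; congr (_ * _).
    apply: eq_big => [t|t /andP[]]; last by rewrite eq_sym => /negPf->.
    by rewrite -val_eqE /= neq_ltn; case: ltngtP.
  apply: eq_big => [t|t /andP[]]; last by rewrite eq_sym => /negPf->.
  by rewrite -val_eqE /= neq_ltn; case: ltngtP.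
apply: eq_constM; first exact: eq_const_refl.
rewrite expr2; apply: eq_constM; first exact: eq_const_refl.
rewrite (exchange_big_dep xpredT) //=; apply: eq_const_prod => s _;
  apply: eq_const_prod => t st.
by rewrite -opprB; apply: eq_constN.
Qed.

(** The part [tri L] of each exponent in [red_nu1] contributes [(U * Delta ^+ 2) ^+ tri L]. Together
    with [Delta ^+ L] this matches [red_delta] at 1, because [L + 2 tri L] is the square of [L]; so
    the auxiliary [L] disappears and only the exponents [l s] remain. *)
Lemma schur_eq_const (f : F) (l : 'I_d.+1 -> nat) (r k : nat) :
  (forall s, \sum_(i < L) b s i = l s + tri L)%N ->
  f * U ^+ r * red_delta u 1 b L = (-1) ^+ k * red_nu u 1 b L ->
  eqc f (U ^- r * \prod_(s < d.+1) \prod_(t < d.+1) wfactor s t ^+ l s).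
Proof.
move=> bl ef; set W := \prod_s _.
have UD0 : U ^+ r * (Delta ^+ (L * L) * U ^+ tri L) != 0.
  by rewrite !mulf_neq0 ?expf_neq0 ?U_neq0 ?Delta_neq0.
apply: (eq_const_cancel UD0).
have -> : U ^- r * W * (U ^+ r * (Delta ^+ (L * L) * U ^+ tri L)) =
    W * (Delta ^+ (L * L) * U ^+ tri L).
  by rewrite mulrACA mulVf ?mul1r // expf_neq0 // U_neq0.
rewrite mulrA; apply: (@eq_const_trans _ _ _ (f * U ^+ r * red_delta u 1 b L)).
  by apply: eq_constM; [exact: eq_const_refl | exact/eq_const_sym/red_delta1].
rewrite ef -signr_odd; apply: (@eq_const_trans _ _ _ (red_nu u 1 b L)).
  case: odd; rewrite ?expr1 ?expr0 ?mulN1r ?mul1r; first exact: eq_constN.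
  exact: eq_const_refl.
apply: (eq_const_trans red_nu1).
have -> : \prod_(s < d.+1) \prod_(t < d.+1) wfactor s t ^+ (\sum_(i < L) b s i) =
    W * (\prod_(s < d.+1) \prod_(t < d.+1) wfactor s t) ^+ tri L.
  rewrite /W -prodrXl -big_split; apply: eq_bigr => s _ /=.
  rewrite -prodrXl -big_split; apply: eq_bigr => t _ /=.
  by rewrite bl exprD.
rewrite mulrCA; apply: eq_constM; first exact: eq_const_refl.
apply: (@eq_const_trans _ _ _ (Delta ^+ L * (U * Delta ^+ 2) ^+ tri L)).
  by apply: eq_constM; [exact: eq_const_refl | exact/eq_constX/prod_wfactor].
rewrite exprMn -exprM -triE mulrCA -exprD mulrC.
rewrite [(2 * _)%N]mul2n -addnn addnA; exact: eq_const_refl.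
Qed.

End SpecializedSchur.

Lemma laurent_schur_shape (K F : fieldType) (iota : {rmorphism K -> F}) (q : F)
    (d r : nat) (u : 'I_d.+1 -> F) (l : 'I_d.+1 -> nat) : q != 0 ->
  (forall j, laurent_in_q iota q (u j)) -> (forall j, laurent_in_q iota q (u j)^-1) ->
  (forall s t, s != t -> laurent_in_q iota q (u s - u t)) ->
  laurent_in_q iota q
    ((\prod_j u j) ^- r * \prod_(s < d.+1) \prod_(t < d.+1) wfactor u s t ^+ l s).
Proof.
move=> q0 uq uVq usub; apply: (laurent_in_qM q0).
  rewrite -exprVn -prodfV; apply: (laurent_in_qX q0).
  by apply: (laurent_in_q_prod q0).
apply: (laurent_in_q_prod q0) => s _; apply: (laurent_in_q_prod q0) => t _.
apply: (laurent_in_qX q0); rewrite /wfactor; case: eqP => [//|/eqP].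
exact: usub.
Qed.

Lemma schur_cancel (F : fieldType) (c x D N U X : F) (k r n : nat) :
  D != 0 -> U != 0 -> X != 0 ->
  c * x ^+ k * X ^- r * U ^- r * (X ^+ (r + n) * N / (X ^+ n * D)) * U ^+ r * D =
  c * x ^+ k * N.
Proof.
by move=> D0 U0 X0; rewrite exprD; field; rewrite D0 !expf_neq0.
Qed.

(** As [f] sends [x - 1] to 0, the powers of [x - 1] are cancelled generically first; the identity
    with cleared denominators then holds in the Laurent ring, where [f] applies. *)
Lemma schur_identity (d r : nat) (lam : 'I_d.+1 -> seq nat) (s : laurent d)
    (F : fieldType) (f : {rmorphism laurent d -> F}) :
  is_multipartition r lam -> f (lau_x d) = 1 ->
  (forall L, red_delta (fun j => f (lau_u j)) 1 (beta lam L) L != 0) ->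
  is_schur_element r lam s ->
  exists L k, (forall a, (size (lam a) <= L)%N) /\
    f s * (\prod_j f (lau_u j)) ^+ r * red_delta (fun j => f (lau_u j)) 1 (beta lam L) L
    = (-1) ^+ k * red_nu (fun j => f (lau_u j)) 1 (beta lam L) L.
Proof.
move=> [lamP lam_r] fx fdelta [L [lamL sE]]; exists L, (schur_aL d r L); split=> //.
set D := red_delta (@lau_u d) (lau_x d) (beta lam L) L.
set N := red_nu (@lau_u d) (lau_x d) (beta lam L) L.
have fD : f D = red_delta (fun j => f (lau_u j)) 1 (beta lam L) L.
  by rewrite rmorph_red_delta fx.
have fN : f N = red_nu (fun j => f (lau_u j)) 1 (beta lam L) L.
  by rewrite rmorph_red_nu fx.
(* The exponent is the sum of all [beta], in which the component sizes add up to [r]. The prefactor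
   of the Schur element cancels these [r] factors [x - 1], and [schur_delta] the others. *)
have nuE : schur_nu lam L = (genx d - 1) ^+ (r + d.+1 * tri L)%N * laurent_incl N.
  rewrite rmorph_red_nu /schur_nu nu_split; congr (_ ^+ _ * _).
  rewrite -lam_r (eq_bigr (fun a => sumn (lam a) + tri L)%N) => [|a _].
    by rewrite big_split /= sum_nat_const card_ord.
  exact: sum_beta.
have deltaE : schur_delta lam L = (genx d - 1) ^+ (d.+1 * tri L)%N * laurent_incl D.
  rewrite rmorph_red_delta /schur_delta delta_split // => a i j ij jL.
  by apply/ltnW/beta_lt => //; case: (lamP a).
clearbody D N; rewrite -fD -fN.
(* The generic reduced denominator is nonzero because its specialization is. *)
have D0 : laurent_incl D != 0.
  apply/negP => /eqP D0; have eD : D = 0 by apply: laurent_incl_inj; rewrite D0 rmorph0.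
  by have := fdelta L; rewrite -fD eD rmorph0 eqxx.
have U0 : \prod_(j < d.+1) genu j != 0 by apply/prodf_neq0 => j _; apply: genu_neq0.
suff : s * (\prod_j lau_u j) ^+ r * D =
    (-1) ^+ schur_aL d r L * lau_x d ^+ schur_bL d L * N.
  move/(congr1 f); rewrite !rmorphM !rmorphXn rmorphN1 fx expr1n mulr1.
  by rewrite rmorph_prod.
apply: laurent_incl_inj.
rewrite !rmorphM !rmorphXn rmorphN1 rmorph_prod sE /schur_formula nuE deltaE.
rewrite -[\prod_i laurent_incl _]/(\prod_(i < d.+1) genu i) -[laurent_incl (lau_x d)]/(genx d).
exact: schur_cancel D0 U0 (genx_sub1_neq0 d).
Qed.

(** * The field K(y) and its subring R_K(y) *)

Section ConcreteFields.
Variables (K : fieldType) (zeta : K).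

Fact Kyc_zmod_morphism : zmod_morphism (@Kyc K).
Proof. by move=> a b; rewrite /Kyc !rmorphB. Qed.
Fact Kyc_monoid_morphism : monoid_morphism (@Kyc K).
Proof. by split=> [|a b]; rewrite /Kyc ?rmorph1 ?rmorphM. Qed.
HB.instance Definition _ :=
  GRing.isZmodMorphism.Build K (Ky K) (@Kyc K) Kyc_zmod_morphism.
HB.instance Definition _ :=
  GRing.isMonoidMorphism.Build K (Ky K) (@Kyc K) Kyc_monoid_morphism.

Lemma Kyy_neq0 : Kyy K != 0.
Proof. by rewrite tofrac_eq0 polyX_eq0. Qed.

Lemma Kyy_expn_sub1_neq0 N : (0 < N)%N -> Kyy K ^+ N - 1 != 0.
Proof.
move=> N_gt0; rewrite /Kyy -rmorphXn -(rmorph1 (@tofrac _)) -[_ - _]rmorphB tofrac_eq0.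
by rewrite -size_poly_eq0 size_XnsubC.
Qed.

Lemma RK_const (z : ZK zeta) : Kyc (srval z) \in gen_subring (RK_gens zeta).
Proof.
case: z => z /= /asboolP /(_ (fun c => Kyc c \in gen_subring (RK_gens zeta))); apply.
  split=> [|a b Ha Hb|a b Ha Hb].
  - change (Kyc (1 : K) \in gen_subring (RK_gens zeta)).
    by rewrite rmorph1 rpred1.
  - change (Kyc (a - b) \in gen_subring (RK_gens zeta)).
    by rewrite rmorphB rpredB.
  - change (Kyc (a * b) \in gen_subring (RK_gens zeta)).
    by rewrite rmorphM rpredM.
by move=> _ ->; apply: mem_gen_subring; apply: Or41.
Qed.

Lemma RK_incl_inj : injective (@RK_incl K zeta).
Proof. exact: val_inj. Qed.

Variables (d r w : nat) (m : 'I_d.+1 -> int).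
Hypotheses (w_gt0 : (0 < w)%N) (r_gt0 : (0 < r)%N).
Hypothesis zeta_prim : d.+1.-primitive_root zeta.
Hypothesis m_assoc : associated_with zeta r m 0 (@hyperplaneN d).
Local Notation u := (cyc_param (@Kyc K) zeta w (Kyy K) m).

Lemma RK_param_subV s t : s != t ->
  (u s - u t)^-1 \in gen_subring (RK_gens zeta) /\ u s - u t != 0.
Proof.
have ky : Kyy K \in gen_subring (RK_gens zeta) by apply: mem_gen_subring; apply: Or42.
have kyV : (Kyy K)^-1 \in gen_subring (RK_gens zeta) by apply: mem_gen_subring;
  apply: Or43.
have kN N : (0 < N)%N -> Kyy K ^+ N - 1 != 0 /\
    (Kyy K ^+ N - 1)^-1 \in gen_subring (RK_gens zeta).
  move=> N_gt0; split; first exact: Kyy_expn_sub1_neq0.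
  by apply: mem_gen_subring; apply: Or44; exists N.
exact: (rk_cyc_param_subV w_gt0 zeta_prim Kyy_neq0 ky kyV RK_const kN r_gt0 m_assoc).
Qed.

End ConcreteFields.

(** * Specialized parameters and Schur elements over K(y) *)

Section Proof.
Variables (K : fieldType) (zeta : K) (d r w : nat) (m : 'I_d.+1 -> int).
Hypotheses (K_char0 : forall n, n.+1%:R != 0 :> K) (w_gt0 : (0 < w)%N) (r_gt0 : (0 < r)%N).
Hypothesis zeta_prim : d.+1.-primitive_root zeta.
Hypothesis m_assoc : associated_with zeta r m 0 (@hyperplaneN d).
Variable phi : {rmorphism laurent d -> RK zeta}.
Hypothesis phi_spec : cyclotomic_specialization w phi m 0.
Let f : {rmorphism laurent d -> Ky K} := RK_incl \o phi.
Let u := cyc_param (@Kyc K) zeta w (Kyy K) m.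

Lemma phi_u j : RK_incl (phi (lau_u j)) = u j.
Proof. exact: phi_spec.1. Qed.

Lemma phi_x : phi (lau_x d) = 1.
Proof. by apply: RK_incl_inj; rewrite rmorph1 phi_spec.2 expr0z. Qed.

Lemma phi_u_inv : exists v : 'I_d.+1 -> 'I_d.+1 -> RK zeta,
  forall a b, a != b -> (phi (lau_u a) - phi (lau_u b)) * v a b = 1.
Proof.
have /choice[v vP] (ab : 'I_d.+1 * 'I_d.+1) : exists v : RK zeta,
    ab.1 != ab.2 -> (phi (lau_u ab.1) - phi (lau_u ab.2)) * v = 1.
  have [->|nab] := eqVneq ab.1 ab.2; first by exists 0.
  have [kV nz] := RK_param_subV w_gt0 r_gt0 zeta_prim m_assoc nab.
  exists (SubringT kV) => _; apply: RK_incl_inj.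
  by rewrite rmorphM rmorphB !phi_u rmorph1; apply: divff.
by exists (fun a b => v (a, b)) => a b /(vP (a, b)).
Qed.

Let u_neq0 j : u j != 0.
Proof. exact: (cyc_param_neq0 _ _ zeta_prim (Kyy_neq0 K)). Qed.

Let u_sub s t : s != t -> u s - u t != 0.
Proof. by case/(RK_param_subV w_gt0 r_gt0 zeta_prim m_assoc). Qed.

(** The sizes enter through a separate function [l], so that multipartitions with equal component
    sizes get literally the same right-hand side. *)
Lemma phi_schur (l : 'I_d.+1 -> nat) lam s : (forall a, sumn (lam a) = l a) ->
  is_multipartition r lam -> is_schur_element r lam s ->
  eq_const (@Kyc K) (RK_incl (phi s))
    ((\prod_j u j) ^- r * \prod_(a < d.+1) \prod_(b < d.+1) wfactor u a b ^+ l a).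
Proof.
move=> sz lamP sP; have fu : (fun j => f (lau_u j)) = u by apply/funext => j;
  apply: phi_u.
have fx : f (lau_x d) = 1 by rewrite /f /= phi_x.
have b_lt L a i j : (i < j)%N -> (j < L)%N -> (beta lam L a j < beta lam L a i)%N.
  by apply: beta_lt; case: (lamP.1 a).
have delta0 L : red_delta (fun j => f (lau_u j)) 1 (beta lam L) L != 0.
  by rewrite fu; apply: (red_delta1_neq0 (@Kyc K) K_char0 u_neq0 u_sub (b_lt L)).
have [L [k [lamL]]] := schur_identity lamP fx delta0 sP.
rewrite fu (eq_bigr u) => [|j _]; last exact: phi_u.
move=> e; apply: (schur_eq_const (@Kyc K) K_char0 u_neq0 u_sub (b_lt L) _ e).
by move=> a; rewrite -sz; apply: sum_beta.
Qed.

Lemma laurent_schur (l : 'I_d.+1 -> nat) : laurent_in_q (@Kyc K) (Kyy K ^+ w)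
  ((\prod_j u j) ^- r * \prod_(a < d.+1) \prod_(b < d.+1) wfactor u a b ^+ l a).
Proof.
have q0 := q_neq0 w (Kyy_neq0 K).
apply: (laurent_schur_shape (iota := @Kyc K) r (u := u) l q0) => [j|j|a b ab].
- exact: (laurent_in_q_param _ _ _ zeta_prim).
- exact: (laurent_in_q_paramV _ _ _ zeta_prim).
- exact: (laurent_in_q_param_sub q0 zeta_prim (u_sub ab)).
Qed.

End Proof.

Lemma fieldExt_rat_char0 (K : fieldExtType rat) n : n.+1%:R != 0 :> K.
Proof. by rewrite -scaler_nat scaler_eq0 oner_eq0 pnatr_eq0. Qed.

Lemma card_roots_of_unity_gt0 (K : fieldType) w :
  (@roots_of_unity K #= `I_w)%card -> (0 < w)%N.
Proof.
case: w => // ; rewrite II0 card_eq0 => /eqP roots0.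
have : @roots_of_unity K 1 by exists 1%N.
by rewrite roots0.
Qed.

Local Open Scope classical_set_scope.

(* [d.+1] is the integer called d in the mathematics. *)
Theorem proposition3p21 (d r : nat) (r_gt0 : (0 < r)%N)
    (K : fieldExtType rat) (zeta : K)
    (zeta_prim : d.+1.-primitive_root zeta)
    (K_gen : <<1; zeta>>%VS = fullv)
    (w : nat) (w_card : (@roots_of_unity K #= `I_w)%card)
    (lam mu : 'I_d.+1 -> seq nat)
    (lam_part : is_multipartition r lam) (mu_part : is_multipartition r mu)
    (phi : {rmorphism laurent d -> RK zeta}) (m : 'I_d.+1 -> int)
    (phi_spec : cyclotomic_specialization w phi m 0)
    (phi_assoc : associated_with zeta r m 0 (@hyperplaneN d))
    (chi_lam chi_mu : generic_AK_Qux d r -> Qux d)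
    (chi_lamP : is_specht_character lam chi_lam)
    (chi_muP : is_specht_character mu chi_mu)
    (psi_lam psi_mu : cyc_AK_Ky r phi -> Ky K)
    (psi_lamP : specialized_character chi_lam psi_lam)
    (psi_muP : specialized_character chi_mu psi_mu)
    (s_lam s_mu : laurent d)
    (s_lamP : is_schur_element r lam s_lam)
    (s_muP : is_schur_element r mu s_mu) :
  same_rouquier_block psi_lam psi_mu ->
  (exists a : int, has_val_q w (RK_incl (phi s_lam)) a /\
                   has_val_q w (RK_incl (phi s_mu)) a) /\
  (exists A : int, has_deg_q w (RK_incl (phi s_lam)) A /\
                   has_deg_q w (RK_incl (phi s_mu)) A).
Proof.
move=> same; have w_gt0 := card_roots_of_unity_gt0 w_card.
have K_char0 := @fieldExt_rat_char0 K.
have [v uv] := phi_u_inv w_gt0 r_gt0 zeta_prim phi_assoc phi_spec.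
have sizes := same_block_sizes K_char0 r_gt0 (phi_x phi_spec) uv
  chi_lamP chi_muP psi_lamP psi_muP same.
(* By [sizes] the same [l] serves [mu], so both specialized Schur elements are constants times one
   Laurent polynomial. *)
pose l a := sumn (lam a).
have schur := phi_schur K_char0 w_gt0 r_gt0 zeta_prim phi_assoc phi_spec (l := l).
have [c c0 lamE] := schur _ _ (fun=> erefl) lam_part s_lamP.
have [c' c'0 muE] := schur _ _ (fun a => esym (sizes a)) mu_part s_muP.
have Wq := laurent_schur w_gt0 r_gt0 zeta_prim phi_assoc l.
have [a [P [P' [P0 P'0 szP -> ->]]]] := val_deg_const_mul c0 c'0 Wq lamE muE.
have nz (Q : {poly K}) : Q`_0 != 0 -> Q != 0 by apply: contraNneq => ->; rewrite coef0.
split; first by exists a; split; [exists P | exists P'].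
exists (a + (size P).-1%:Z); split; [exists P, a | exists P', a; rewrite szP].
  by split=> //; apply: nz.
by split=> //; apply: nz.
Qed.
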